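(* Let $\mathcal{A}=\{(2,0),(2,1),(4,3),(5,4),(5,6)\}$. Every pair of integers $(m,f)$ with $m\ge 2$, $0\le f\le\binom{m}{2}$ and $(m,f)\notin\mathcal{A}$ satisfies $\sigma(m,f)\le \frac12$. Moreover, there are infinitely many pairs $(m,f)$ with $\sigma(m,f)=\frac12$.
   Context: All graphs are finite and simple. For integers $m\ge 2$ and $0\le f\le \binom{m}{2}$, write $(n,e)\rightarrow(m,f)$ if every $n$-vertex graph with exactly $e$ edges contains an induced subgraph on $m$ vertices with exactly $f$ edges. Let $S_n(m,f)=\{e\in\{0,1,\dots,\binom n2\}: (n,e)\rightarrow(m,f)\}$ and $\sigma(m,f)=\limsup_{n\to\infty}|S_n(m,f)|/\binom{n}{2}$. *)

(* Defs.v *)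
From mathcomp Require Import all_boot all_order all_algebra.
From mathcomp Require Import all_classical all_reals all_analysis.

Set Implicit Arguments.
Unset Strict Implicit.
Unset Printing Implicit Defensive.

Import GRing.Theory Num.Theory.

Local Open Scope nat_scope.

(* A simple graph on the vertex type V is given by its set of edges, each edge
   being an unordered pair of distinct vertices. *)
Definition simple_graph (V : finType) (G : {set {set V}}) : bool :=
  [forall a in G, #|a| == 2].

Definition induced (V : finType) (G : {set {set V}}) (U : {set V}) :
    {set {set V}} :=
  [set a in G | a \subset U]%SET.

Definition arrow (n e m f : nat) : bool :=
  [forall G : {set {set 'I_n}},
    simple_graph G && (#|G| == e) ==>
    [exists U : {set 'I_n}, (#|U| == m) && (#|induced G U| == f)]].

Definition S_ (n m f : nat) : {set 'I_('C(n, 2).+1)} :=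
  [set e : 'I_('C(n, 2).+1) | arrow n e m f]%SET.

(* For n < 2 the denominator is 0 and the quotient is 0 by convention; this
   does not affect the limsup. *)
Definition sigma (R : realType) (m f : nat) : \bar R :=
  limn_esup (fun n : nat => ((#|S_ n m f|%:R / 'C(n, 2)%:R)%R : R)%:E).

Definition calA : seq (nat * nat) :=
  [:: (2, 0); (2, 1); (4, 3); (5, 4); (5, 6)].

(* Main.v *)
(** Write [g = 'C(m, 2) - f]; complementation exchanges [f] and [g]. If no
[m]-vertex induced subgraph of any member of a family of graphs has [f] edges,
the edge counts realised by the family are excluded from [S_n(m, f)]. Up to
O(n), each of the following families realises half of all edge counts:
bipartite graphs; [K_x] together with a disjoint star (since the sum of
[min(x, n - x)] over [x <= n] is about [n^2/4]); [K_x] minus a matching. Hence,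
if sigma exceeds 1/2, both [f] and [g] are at most [m^2/4], lie in windows just
above a triangular number and in windows just below one. For [m >= 19] this
forces [f = g = 'C(k, 2)], and a balanced complete bipartite graph with a
disjoint star then forces [m = v^2]. The resulting equation
[v^2 (v^2 - 1) = 2 k (k - 1)] has no solution with [v > 2], by descent on pairs
[a, b] such that [a^2 + b^2] and [a^2 - b^2] are both squares. For [m < 19] the
only pairs left outside [calA] are (3, 1) and (3, 2), which disjoint unions of
cliques (or their complements) avoid.

For equality, a large graph of edge density in [[eps, 1/2 - eps]] contains, for
every [t], an induced clique and independent set of size [t] with no or all
edges between them, an induced [K_{t,t}], or three disjoint cliques of size [t]
without edges between them. All four patterns contain an induced [m]-set with
[f] edges when [m = 5 q + 2] and [f = 'C(3 q + 1, 2)], because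
[f + 'C(4 q + 2, 2) = 'C(m, 2)], [f = 2 'C(2 q + 1, 2) + 'C(q, 2)], and
[f = a (m - a)] as soon as [7 (q + 1)^2 - 3] is a square, which a Pell
recursion achieves infinitely often. *)

From mathcomp Require Import all_boot all_order all_algebra.
From mathcomp Require Import all_classical all_reals all_analysis.
From mathcomp Require Import zify lra.
Require Import Defs.

Set Implicit Arguments.
Unset Strict Implicit.
Unset Printing Implicit Defensive.

Local Open Scope nat_scope.

(** * A quartic Diophantine equation *)

(** Each factor is the square of its gcd with [c]: putting [x = x' d], [c = c' d] with
    [d = gcdn x c] gives [x' y = c'^2 d], and coprimality yields both [x' %| d] and [d %| x']. *)
Lemma coprime_sqr_factor (a b c : nat) :
  coprime a b -> a * b = c ^ 2 -> exists r s, [/\ a = r ^ 2, b = s ^ 2 & c = r * s].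
Proof.
have factor x y : coprime x y -> x * y = c ^ 2 -> x = gcdn x c ^ 2.
  move=> cxy Exy; have [c0|c_gt0] := posnP c.
    move: Exy; rewrite c0 gcdn0; move: cxy.
    have [->|x0] := posnP x; first by [].
    have [->|y0] := posnP y; last by move=> _; nia.
    by rewrite /coprime gcdn0 => /eqP->.
  have [x0|x_gt0] := posnP x; first by nia.
  set d := gcdn x c; have d0 : 0 < d by rewrite gcdn_gt0 x_gt0.
  have /dvdnP[x' Ex] : d %| x by apply: dvdn_gcdl.
  have /dvdnP[c' Ec] : d %| c by apply: dvdn_gcdr.
  have cop : coprime x' c'.
    have : gcdn (x' * d) (c' * d) = 1 * d by rewrite -Ex -Ec mul1n.
    by rewrite -muln_gcdl => /eqP; rewrite eqn_pmul2r.
  have E2 : x' * y = c' ^ 2 * d by rewrite Ex Ec in Exy; nia.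
  have Ed : x' %| d.
    by rewrite -(@Gauss_dvdr x' (c' ^ 2)) ?coprimeXr // -E2 dvdn_mulr.
  have dx : d %| x'.
    rewrite -(@Gauss_dvdl d x' y) ?E2 ?dvdn_mull //.
    by apply: coprime_dvdl cxy; rewrite Ex dvdn_mull.
  by rewrite {1}Ex -mulnn; congr (_ * _); apply/eqP; rewrite eqn_dvd Ed dx.
move=> cab Eab; exists (gcdn a c), (gcdn b c).
have Ea := factor a b cab Eab.
have Eb : b = gcdn b c ^ 2 by apply: (factor b a); rewrite 1?coprime_sym // mulnC.
split=> //; apply/eqP; rewrite -(@eqn_exp2r _ _ 2) // expnMn -Ea -Eb Eab //.
Qed.

(** With [y = 2 y'] and [z = x + 2 d] the equation becomes [(x + d) d = y'^2], whose coprime factors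
    are the squares of [a] and [b]. The leg [x] is described by an addition to avoid truncated
    subtraction. *)
Lemma pythagorean_primitive (x y z : nat) :
  coprime x y -> ~~ odd y -> x ^ 2 + y ^ 2 = z ^ 2 ->
  exists a b, [/\ coprime a b, odd (a + b), a ^ 2 = x + b ^ 2, y = 2 * (a * b)
    & z = a ^ 2 + b ^ 2].
Proof.
move=> cxy ey E.
have ox : odd x.
  apply: contraTT cxy => ex; rewrite /coprime; apply/negP => /eqP g1.
  have: 2 %| gcdn x y by rewrite dvdn_gcd !dvdn2 ex ey.
  by rewrite g1.
have oz : odd z.
  have: odd (z ^ 2) by rewrite -E oddD !oddX /= ox (negbTE ey).
  by rewrite oddX.
have xz : x <= z by nia.
have [y' Ey] : exists y', y = 2 * y' by exists y./2; lia.
have [d Ed] : exists d, z = x + 2 * d by exists (z - x)./2; lia.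
have E1 : (x + d) * d = y' ^ 2 by nia.
have cop : coprime (x + d) d.
  rewrite /coprime -dvdn1; set g := gcdn _ _.
  have gd : g %| d by apply: dvdn_gcdr.
  have gx : g %| x by rewrite -(dvdn_addl _ gd) dvdn_gcdl.
  have cgy : coprime g (y ^ 2) by rewrite coprimeXr //; apply: coprime_dvdl cxy.
  rewrite -(eqP cgy) dvdn_gcd dvdnn Ey expnMn -E1 mulnA dvdn_mull //.
have [a [b [Ea Eb Eab]]] := coprime_sqr_factor cop E1.
exists a, b; split.
- by move: cop; rewrite Ea Eb coprime_pexpl // coprime_pexpr.
- have: odd (x + d + d) by lia.
  by rewrite Ea Eb oddD !oddX /= oddD.
- by rewrite -Ea -Eb.
- by rewrite Ey Eab.
- by rewrite -Ea -Eb; lia.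
Qed.

(* Infinite descent: the half-sum and half-difference of [u] and [w] are the
   legs of a primitive triangle with hypotenuse [a]; its generators are squares
   whose roots form a smaller instance. *)
Lemma no_concordant_squares (a b u w : nat) :
  coprime a b -> 0 < b -> w ^ 2 + b ^ 2 = a ^ 2 -> a ^ 2 + b ^ 2 = u ^ 2 -> False.
Proof.
elim/ltn_ind: a b u w => a IH b u w cab b0 Ew Eu.
(* Modulo 4: for odd [b], either [a] is odd and [u^2] would be 2, or [a] is even and [w^2] would be
   3. *)
have eb : ~~ odd b.
  apply/negP => ob; have [oa|ea] := boolP (odd a).
    have [b' Eb'] : exists b', b = 2 * b' + 1 by exists b./2; lia.
    have [a' Ea'] : exists a', a = 2 * a' + 1 by exists a./2; lia.
    have [u' [Eu'|Eu']] : exists u', u = 2 * u' \/ u = 2 * u' + 1 by exists u./2; lia.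
      by nia.
    by nia.
  have [b' Eb'] : exists b', b = 2 * b' + 1 by exists b./2; lia.
  have [a' Ea'] : exists a', a = 2 * a' by exists a./2; lia.
  have [w' [Ew'|Ew']] : exists u', w = 2 * u' \/ w = 2 * u' + 1 by exists w./2; lia.
    by nia.
  by nia.
have oa : odd a.
  apply: contraTT cab => ea; rewrite /coprime; apply/negP => /eqP g1.
  have: 2 %| gcdn a b by rewrite dvdn_gcd !dvdn2 ea eb.
  by rewrite g1.
have ow : odd w.
  have: odd (w ^ 2 + b ^ 2) by rewrite Ew oddX oa.
  by rewrite oddD !oddX /= (negbTE eb); case: (odd w).
have ou : odd u.
  have: odd (u ^ 2) by rewrite -Eu oddD !oddX /= (negbTE eb) oa.
  by rewrite oddX.
have wu : w < u by clear -b0 Ew Eu; nia.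
have [c Ec] : exists c, b = 2 * c by exists b./2; lia.
have [Y EY] : exists Y, u = w + 2 * Y by exists (u - w)./2; lia.
set X := w + Y.
have EXY : X ^ 2 + Y ^ 2 = a ^ 2 by clear -Ew Eu EY; rewrite /X; nia.
have EP : X * Y = 2 * c ^ 2 by clear -Ew Eu EY Ec; rewrite /X; nia.
have cXY : coprime X Y.
  rewrite /coprime -dvdn1; set g := gcdn _ _.
  have gX : g %| X by apply: dvdn_gcdl.
  have gY : g %| Y by apply: dvdn_gcdr.
  have g2a : g ^ 2 %| a ^ 2.
    by rewrite -EXY dvdn_add // dvdn_exp2r.
  have ga : g %| a by rewrite dvdn_pexp2r in g2a.
  have gb : g ^ 2 %| b ^ 2.
    have -> : b ^ 2 = 2 * (X * Y) by rewrite EP Ec expnMn mulnA.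
    by rewrite dvdn_mull // -mulnn dvdn_mul.
  rewrite dvdn_pexp2r // in gb.
  by rewrite -(eqP cab) dvdn_gcd ga gb.
(* Either leg may be the even one; in both cases [X Y = 2 p q (p^2 - q^2)], which equals [2 c^2]. *)
have [p [q [cpq opq Ep Eq Ea]]] : exists p q, [/\ coprime p q, odd (p + q),
    q < p, p * q * ((p - q) * (p + q)) = c ^ 2 & a = p ^ 2 + q ^ 2].
  have [oY|eY] := boolP (odd Y); last first.
    have oX : odd X.
      have: odd (X ^ 2 + Y ^ 2) by rewrite EXY oddX oa.
      by rewrite oddD !oddX /= (negbTE eY); case: (odd X).
    have [p [q [cpq opq E1 E2 E3]]] := pythagorean_primitive cXY eY EXY.
    have qp : q < p by clear -E1 oX; nia.
    exists p, q; split=> //.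
    have [d Ed] : exists d, p = q + d by exists (p - q); clear -qp; lia.
    clear -E1 E2 EP Ed; subst p; rewrite addKn; nia.
  have eX : ~~ odd X.
    have: ~~ odd (X * Y) by rewrite EP oddM.
    by rewrite oddM oY andbT.
  have cYX : coprime Y X by rewrite coprime_sym.
  have [|p [q [cpq opq E1 E2 E3]]] := @pythagorean_primitive Y X a cYX eX.
    by rewrite addnC.
  have qp : q < p by clear -E1 oY; nia.
  exists p, q; split=> //.
  have [d Ed] : exists d, p = q + d by exists (p - q); clear -qp; lia.
  clear -E1 E2 EP Ed; subst p; rewrite addKn; nia.
have [d Ed] : exists d, p = q + d by exists (p - q); clear -Ep; lia.
have Epq : p - q = d by clear -Ed; lia.
rewrite {}Epq in Eq.
have cqd : coprime q d.
  by move: cpq; rewrite coprime_sym /coprime Ed gcdnDl.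
have cpd : coprime p d.
  by rewrite coprime_sym /coprime Ed gcdnDr gcdnC.
have cps : coprime p (p + q) by rewrite /coprime gcdnDl.
have cqs : coprime q (p + q) by rewrite /coprime gcdnDr gcdnC.
have cds : coprime d (p + q).
  have -> : p + q = 2 * q + d by clear -Ed; lia.
  rewrite /coprime gcdnDr -/(coprime _ _) coprimeMr [coprime d q]coprime_sym cqd.
  by rewrite andbT coprimen2; clear -Ed opq; lia.
(* The factors [p], [q], [d = p - q] and [p + q] are pairwise coprime, hence all squares; with
   [p = r^2] and [q = s^2], the pair [r], [s] is the smaller instance. *)
have [x [y [Ex Ey Exy]]] : exists r s, [/\ p * q = r ^ 2, d * (p + q) = s ^ 2 & c = r * s].
  apply: coprime_sqr_factor Eq.
  by rewrite coprimeMl !coprimeMr cpd cqd cps cqs.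
have [r [s [Er Es _]]] := coprime_sqr_factor cpq Ex.
have [w' [u' [Ew' Eu' _]]] := coprime_sqr_factor cds Ey.
have s0 : 0 < s.
  have: 0 < c by clear -Ec b0; lia.
  rewrite Exy muln_gt0 => /andP[x0 _].
  have: 0 < p * q by rewrite Ex expn_gt0 x0.
  by rewrite Es muln_gt0 expn_gt0 orbF => /andP[].
have ra : r < a by clear -Ea Er s0 Es; nia.
have crs : coprime r s by move: cpq; rewrite Er Es coprime_pexpl // coprime_pexpr.
apply: (IH r ra s u' w' crs s0).
- by rewrite -Ew' -Es -Er; clear -Ed; lia.
- by rewrite -Er -Es.
Qed.

(** With [2 x = (c^4 - 1) / 2], the numbers [c^2], [2 x], [d^4] form a primitive Pythagorean triple.
    Its generators satisfy [a^2 - b^2 = c^2] and [a^2 + b^2 = d^4], which the descent forbids. *)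
Lemma quartic_double (c d : nat) : c ^ 4 + 1 = 2 * d ^ 4 -> c <= 1.
Proof.
move=> E; rewrite leqNgt; apply/negP => c1.
have oc : odd c.
  have: odd (c ^ 4 + 1) = false by rewrite E oddM.
  by rewrite oddD oddX /= addbT => /negbFE.
have [n En] : exists n, c = 2 * n + 1 by exists c./2; clear -oc; lia.
have [x Ex] : exists x, c ^ 4 = 4 * x + 1.
  by exists ((n ^ 2 + n) * (c ^ 2 + 1)); clear -En; subst c; nia.
have cop : coprime (c ^ 2) (2 * x).
  apply: (@coprime_dvdl _ (2 * (2 * x) + 1)).
    have -> : 2 * (2 * x) + 1 = c ^ 2 * c ^ 2 by rewrite -expnD Ex; lia.
    by rewrite dvdn_mulr.
  by rewrite coprime_sym /coprime gcdnMDl gcdn1.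
have ex : ~~ odd (2 * x) by rewrite oddM.
have Ed : 2 * x + 1 = d ^ 4 by clear -E Ex; lia.
have [|a [b [cab _ Ea Eb Ez]]] := @pythagorean_primitive (c ^ 2) (2 * x) (d ^ 4) cop ex.
  have -> : (c ^ 2) ^ 2 = c ^ 4 by rewrite -expnM.
  by rewrite Ex -Ed; clear; nia.
have x0 : 0 < x by clear -Ex c1; nia.
apply: (@no_concordant_squares a b (d ^ 2) c cab).
- by case: b Eb {cab Ea Ez} => //; clear -x0; lia.
- by rewrite Ea.
- by rewrite -Ez -expnM.
Qed.

Lemma sqr_pred_sqr (c e : nat) : c ^ 2 = e ^ 2 + 1 -> e = 0.
Proof. move=> E; have ec : e < c by nia.
by nia. Qed.

Lemma coprime_double_sqr_factor (a b v : nat) : coprime a b -> ~~ odd a -> a * b = 2 * v ^ 2 ->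
  exists r s, [/\ a = 2 * r ^ 2, b = s ^ 2 & v = r * s].
Proof.
move=> cab ea E.
have [a' Ea] : exists a', a = 2 * a' by exists a./2; clear -ea; lia.
have cab' : coprime a' b by apply: coprime_dvdl cab; rewrite Ea dvdn_mull.
have E' : a' * b = v ^ 2 by clear -E Ea; subst a; lia.
have [r [s [Er Es Ev]]] := coprime_sqr_factor cab' E'.
by exists r, s; rewrite Ea Er.
Qed.

(** Writing [z = 2 y + 1] gives [y (y + 1) = 2 r^4], so one of [y], [y + 1] is a fourth power and
    the other twice a fourth power. Odd [y] leads to [c^4 + 1 = 2 d^4], even [y] to
    [c^4 = 2 d^4 + 1]. *)
Lemma eight_quartic (r z : nat) : z ^ 2 = 8 * r ^ 4 + 1 -> r <= 1.
Proof.
move=> E.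
have oz : odd z.
  have: odd (z ^ 2) by rewrite E oddD oddM.
  by rewrite oddX.
have [y Ey] : exists y, z = 2 * y + 1 by exists z./2; clear -oz; lia.
have Er : y * (y + 1) = 2 * (r ^ 2) ^ 2.
  by rewrite -expnM; clear -E Ey; subst z; nia.
have cop : coprime y (y + 1) by rewrite addn1 coprimenS.
have [oy|ey] := boolP (odd y).
  have [|||p [q [Ep Eq Epq]]] := @coprime_double_sqr_factor (y + 1) y (r ^ 2).
  - by rewrite coprime_sym.
  - by rewrite oddD oy.
  - by rewrite mulnC.
  have cpq : coprime p q.
    move: cop; rewrite Ep {1}Eq coprimeMr => /andP[_].
    by rewrite coprime_pexpl // coprime_pexpr // coprime_sym.
  have [d [c [Ed Ec Er']]] := coprime_sqr_factor cpq (esym Epq).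
  have: c ^ 4 + 1 = 2 * d ^ 4.
    by rewrite (expnM c 2 2) (expnM d 2 2) -Ed -Ec -Eq -Ep.
  move=> E1; have c1 := quartic_double E1.
  have d1 : d <= 1 by clear -c1 E1; case: c c1 E1 => [|[|]] // _; nia.
  by rewrite Er'; clear -c1 d1; nia.
have [p [q [Ep Eq Epq]]] := coprime_double_sqr_factor cop ey Er.
have cpq : coprime p q.
  move: cop; rewrite Eq {1}Ep coprime_pexpr // coprimeMl coprime_pexpl //.
  by case/andP.
have [d [c [Ed Ec Er']]] := coprime_sqr_factor cpq (esym Epq).
have E1 : c ^ 4 = 2 * d ^ 4 + 1.
  by rewrite (expnM c 2 2) (expnM d 2 2) -Ed -Ec -Eq -Ep.
have oc : odd c.
  have: odd (c ^ 4) by rewrite E1 oddD oddM.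
  by rewrite oddX.
have [n En] : exists n, c = 2 * n + 1 by exists c./2; clear -oc; lia.
(* Here [A = c^2 - 1] and [B = (c^2 + 1) / 2] are coprime with product [d^4], so [c^2 - 1] is a
   square, hence 0. *)
set B := 2 * (n ^ 2 + n) + 1.
set A := 4 * (n ^ 2 + n).
have EB : c ^ 2 + 1 = 2 * B by clear -En; subst c; rewrite /B; nia.
have EA : c ^ 2 = A + 1 by clear -En; subst c; rewrite /A; nia.
have EAB : A * B = (d ^ 2) ^ 2.
  have : (A + 1) * (A + 1) = 2 * (d ^ 2) ^ 2 + 1.
    by rewrite -EA -expnD -expnM E1.
  by clear; rewrite /A /B; nia.
have cAB : coprime A B.
  have -> : A = 2 * (B - 1) by clear; rewrite /A /B; lia.
  rewrite coprimeMl coprime2n /B addnK; apply/andP; split.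
    by rewrite oddD oddM.
  by rewrite addn1 coprimenS.
have [p' [q' [EA' _ Edd]]] := coprime_sqr_factor cAB EAB.
have p0 : p' = 0 by apply: (@sqr_pred_sqr c); rewrite -EA'.
have d0 : d ^ 2 = 0 by rewrite Edd p0.
have {}d0 : d = 0 by clear -d0; nia.
by rewrite Er' d0.
Qed.

(** The equation is equivalent to [(v^2)^2 + (v^2 - 1)^2 = (2 k - 1)^2], a primitive Pythagorean
    triple; the parity of [v] decides which leg is even. *)
Lemma square_pronic_half (v k : nat) : v ^ 4 + 2 * k = 2 * k ^ 2 + v ^ 2 -> v <= 2.
Proof.
move=> E; have [//|v2] := leqP v 2.
have v0 : 0 < v by clear -v2; lia.
have k0 : 0 < k.
  case: k E => // E; have: v ^ 2 < v ^ 4 by rewrite ltn_exp2l //; clear -v2; lia.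
  by clear -E; lia.
have [l El] : exists l, k = l + 1 by exists (k - 1); clear -k0; lia.
have [t Et] : exists t, v ^ 2 = t + 1 by exists (v ^ 2 - 1); clear -v0; nia.
have EY : (v ^ 2) ^ 2 + t ^ 2 = (2 * l + 1) ^ 2.
  have E4 : v ^ 4 = (t + 1) ^ 2 by rewrite -Et -expnM.
  by rewrite Et; clear -E E4 Et El; subst k; rewrite E4 Et in E; nia.
have cop : coprime (v ^ 2) t by rewrite Et addn1 coprimeSn.
have [ov|ev] := boolP (odd v).
  have et : ~~ odd t.
    have: odd (t + 1) by rewrite -Et oddX.
    by rewrite oddD addbT.
  have [a [b [cab oab Ea Eb _]]] := pythagorean_primitive cop et EY.
  have ba : b < a by clear -Ea v0; nia.
  have [d Ed] : exists d, a = b + d by exists (a - b); clear -ba; lia.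
  have Ed2 : d * (2 * b + d) = v ^ 2 by clear -Ed Ea; subst a; nia.
  have od : odd d by clear -oab Ed; lia.
  have cd : coprime d (2 * b + d).
    rewrite /coprime gcdnDr -/(coprime _ _) coprimeMr coprimen2 od /=.
    by move: cab; rewrite coprime_sym Ed /coprime gcdnDl gcdnC.
  have [q [p [Eq Ep Evv]]] := coprime_sqr_factor cd Ed2.
  (* Since [q^2 = d = a - b], this is [(a - b)^2 = v^2 + 2 b^2 - t] with [v^2 = t + 1]. It forces
     [b = 0], because [q^2] exceeds an even square by one. *)
  have E4 : q ^ 4 = 2 * b ^ 2 + 1.
    by rewrite (expnM q 2 2) -Eq; clear -Ed Ea Eb Et; subst a t; nia.
  have oq : odd q.
    have: odd (q ^ 4) by rewrite E4 oddD oddM.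
    by rewrite oddX.
  have [n En] : exists n, q = 2 * n + 1 by exists q./2; clear -oq; lia.
  pose N := n ^ 2 + n.
  have Eb2 : b ^ 2 = 4 * (N * (2 * N + 1)).
    have Eq2 : q ^ 2 = 4 * N + 1 by clear -En; subst q; rewrite /N; nia.
    have: (4 * N + 1) ^ 2 = 2 * b ^ 2 + 1 by rewrite -Eq2 -expnM E4.
    by clear; nia.
  have eb : ~~ odd b.
    have: ~~ odd (b ^ 2) by rewrite Eb2 oddM.
    by rewrite oddX.
  have [b' Eb'] : exists b', b = 2 * b' by exists b./2; clear -eb; lia.
  have EN : N * (2 * N + 1) = b' ^ 2 by clear -Eb2 Eb'; subst b; nia.
  have cN : coprime N (2 * N + 1) by rewrite /coprime gcdnMDl gcdn1.
  have [x [y [Ex _ Exy]]] := coprime_sqr_factor cN EN.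
  have x0 : 2 * x = 0.
    by apply: (@sqr_pred_sqr q); clear -Ex En; subst q; rewrite /N in Ex; nia.
  have {}x0 : x = 0 by clear -x0; lia.
  have t0 : t = 0 by rewrite Eb Eb' Exy x0; clear; lia.
  by clear -t0 Et v2; nia.
have et : odd t.
  have: odd (t + 1) = false by rewrite -Et oddX /= (negbTE ev).
  by rewrite oddD addbT => /negbFE.
have cop' : coprime t (v ^ 2) by rewrite coprime_sym.
have ev2 : ~~ odd (v ^ 2) by rewrite oddX.
have EY' : t ^ 2 + (v ^ 2) ^ 2 = (2 * l + 1) ^ 2 by rewrite addnC.
have [a [b [cab oab Ea Eb _]]] := pythagorean_primitive cop' ev2 EY'.
have [v' Ev'] : exists v', v = 2 * v' by exists v./2; clear -ev; lia.
have Eab : a * b = 2 * v' ^ 2 by clear -Eb Ev'; subst v; nia.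
have [oa|ea] := boolP (odd a).
  have eb : ~~ odd b by clear -oa oab; lia.
  have cba : coprime b a by rewrite coprime_sym.
  have [|r [s [Er Es Ev]]] := @coprime_double_sqr_factor b a v' cba eb.
    by rewrite mulnC.
  have os : odd s by move: oa; rewrite Es oddX.
  have [n En] : exists n, s = 2 * n + 1 by exists s./2; clear -os; lia.
  have [N EN] : exists N, s ^ 2 = 4 * N + 1.
    by exists (n ^ 2 + n); clear -En; subst s; nia.
  rewrite EN in Es; rewrite Eb Er Es in Et.
  by clear -Ea Es Er Et; subst a b; nia.
have [r [s [Er Es Ev]]] := coprime_double_sqr_factor cab ea Eab.
(* Substitution of [a = 2 r^2] and [b = s^2] in [a^2 - b^2 + 1 = 2 a b], after completing the
   square. *)
have Ez : (s ^ 2 + 2 * r ^ 2) ^ 2 = 8 * r ^ 4 + 1.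
  rewrite (expnM r 2 2) -Es; rewrite Er in Ea Eb.
  by clear -Ea Eb Et; nia.
have r1 := eight_quartic Ez.
have s1 : s <= 1.
  by case: r r1 Ez {Er Ev} => [|[|]] // _; clear; nia.
by clear -Ev' Ev v2 r1 s1; nia.
Qed.

(** * Critical pairs *)

Lemma bin2_sqr (n : nat) : 2 * 'C(n, 2) + n = n ^ 2.
Proof. by elim: n => // n IH; rewrite binS bin1; nia. Qed.

(* Sizes of the [m]-vertex induced subgraphs of a clique with a disjoint star
   ([c] counts the centre, [l] the leaves), of a clique minus a matching, and of
   a complete bipartite graph with a disjoint star. *)
Definition clique_star_size (m f : nat) : Prop :=
  exists k c l, [/\ k + c + l <= m, c <= 1 & f = 'C(k, 2) + c * l].

Definition clique_matching_size (m f : nat) : Prop :=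
  exists k u, [/\ k <= m, 2 * u <= k & f + u = 'C(k, 2)].

Definition bipartite_star_size (m f : nat) : Prop :=
  exists a b c l, [/\ a + b + c + l <= m, c <= 1 & f = a * b + c * l].

(** An executable search. The star contributes fewer than [m - k] edges since its centre takes a
    vertex; for [k = m] only 0 remains. *)
Definition clique_star_sizeb (m f : nat) : bool :=
  has (fun k => has (fun l => f == 'C(k, 2) + l)
                    (if k < m then iota 0 (m - k) else [:: 0])) (iota 0 m.+1).

Definition clique_matching_sizeb (m f : nat) : bool :=
  has (fun k => has (fun u => f + u == 'C(k, 2)) (iota 0 k./2.+1)) (iota 0 m.+1).

Lemma clique_star_sizeP (m f : nat) : clique_star_size m f -> clique_star_sizeb m f.
Proof.
move=> [k [c [l [H c1 ->]]]]; apply/hasP; exists k; first by rewrite mem_iota; lia.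
have [km|mk] := ltnP; apply/hasP.
  by exists (c * l) => //; rewrite mem_iota; case: c c1 H => [|[|]] //; lia.
by exists 0 => //; case: c c1 H => [|[|]] //; lia.
Qed.

Lemma clique_matching_sizeP (m f : nat) :
  clique_matching_size m f -> clique_matching_sizeb m f.
Proof.
move=> [k [u [H u1 E]]]; apply/hasP; exists k; first by rewrite mem_iota; lia.
by apply/hasP; exists u; rewrite ?E // mem_iota; lia.
Qed.

Definition small_cases : seq (nat * nat) :=
  [:: (2, 0); (2, 1); (3, 1); (3, 2); (4, 3); (5, 4); (5, 6)].

Lemma small_critical (m f g : nat) : 2 <= m < 19 -> f + g = 'C(m, 2) ->
  4 * f <= m ^ 2 -> 4 * g <= m ^ 2 ->
  clique_star_size m f -> clique_star_size m g ->
  clique_matching_size m f -> clique_matching_size m g -> (m, f) \in small_cases.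
Proof.
move=> Hm E Hf Hg /clique_star_sizeP sf /clique_star_sizeP sg
  /clique_matching_sizeP cf /clique_matching_sizeP cg.
have Eg : g = 'C(m, 2) - f by lia.
(* From [4 f <= m^2 <= 18^2] follows [f <= 81], so the search is finite. *)
have: all (fun m => all (fun f => let g := 'C(m, 2) - f in
   [&& f <= 'C(m, 2), 4 * f <= m ^ 2, 4 * g <= m ^ 2, clique_star_sizeb m f, clique_star_sizeb m g,
     clique_matching_sizeb m f & clique_matching_sizeb m g]
   ==> ((m, f) \in small_cases)) (iota 0 82)) (iota 2 17) by vm_compute.
move/allP/(_ m); rewrite mem_iota => /(_ ltac:(lia)) /allP /(_ f).
rewrite mem_iota => /(_ ltac:(nia)) /implyP; apply.
by rewrite -Eg Hf Hg sf sg cf cg !andbT; lia.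
Qed.

(** If the star has [j > 0] edges, [f] lies strictly above ['C(k, 2)] and at most [p / 2] below some
    ['C(p, 2)] with [p > k]. Such a gap forces [k <= 2 j + 1]; together with [k + 1 + j <= m] this
    gives [k < 2 m / 3], so [4 f] is about [8 m^2 / 9] at most, too small for [m >= 19]. *)
Lemma clique_star_matching (m f : nat) : 19 <= m -> m * (m - 2) <= 4 * f ->
  clique_star_size m f -> clique_matching_size m f -> exists k, f = 'C(k, 2).
Proof.
move=> m19 Hf [k [c [l [Hk c1 Ef]]]] [p [u [pm up Ep]]].
have [j0|j0] := posnP (c * l); first by exists k; rewrite Ef j0 addn0.
have Hj : k + 1 + c * l <= m by clear -j0 c1 Hk; case: c c1 Hk j0 => [|[|]] //; lia.
have kp : k < p.
  rewrite ltnNge; apply/negP => /(leq_bin2l 2).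
  by clear -Ef Ep j0; lia.
have := bin2_sqr k; have := bin2_sqr p.
move: (c * l) j0 Hj Ef => j j0 Hj Ef; move: ('C(k, 2)) Ef => Ck Ef; move: ('C(p, 2)) Ep => Cp Ep.
move=> Hp Hkk.
have [d Ed] : exists d, p = k + 1 + d by exists (p - k - 1); clear -kp; lia.
have J : k <= 2 * j + 1.
  by clear -Ed Hp Hkk Ef Ep up; subst p f; nia.
exfalso; have [n En] : exists n, m = n + 19 by exists (m - 19); clear -m19; lia.
have K : 3 * k + 1 <= 2 * m by clear -J Hj; lia.
by clear -En Hf Hj K Hkk Ef; subst m f; nia.
Qed.

Lemma critical_pair (m f g : nat) : 19 <= m -> f + g = 'C(m, 2) ->
  4 * f <= m ^ 2 -> 4 * g <= m ^ 2 ->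
  clique_star_size m f -> clique_star_size m g ->
  clique_matching_size m f -> clique_matching_size m g ->
  f = g /\ exists k, f = 'C(k, 2).
Proof.
move=> m19 E Hf Hg sf sg cf cg.
have Em := bin2_sqr m.
have [|k Ek] := @clique_star_matching m f m19 _ sf cf.
  by clear -E Hf Hg Em m19; nia.
have [|k' Ek'] := @clique_star_matching m g m19 _ sg cg.
  by clear -E Hf Hg Em m19; nia.
split; last by exists k.
have := bin2_sqr k; have := bin2_sqr k'; rewrite -Ek -Ek' => H' H.
wlog kk : k k' f g {Hf Hg sf sg cf cg Ek Ek'} E Hf Hg H H' / k <= k'.
  move=> W; have [kk|/ltnW kk] := leqP k k'; first by apply: (W k k').
  by apply/esym; apply: (W k' k) => //; rewrite addnC.
have [kk'|kk'] := ltnP k k'; last first.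
  have E' : k = k' by lia.
  by subst k'; lia.
exfalso.
(* Distinct triangular numbers differ by at least [k], whereas both [4 f] and [4 g] lie between
   [m^2 - 2 m] and [m^2]. Hence [k <= m / 2], which makes [f] too small. *)
have D : k <= g - f /\ f <= g by clear -kk' H H'; nia.
have Hk : 2 * k <= m by clear -D E Hf Hg Em m19; nia.
by clear -Hk H E Hf Hg Em m19; nia.
Qed.

Lemma half_pair_bipartite (m f : nat) : 5 <= m -> 2 * f = 'C(m, 2) ->
  bipartite_star_size m f -> exists v, m = v ^ 2.
Proof.
move=> m5 E [a [b [c [l [H c1 Ef]]]]].
have Em := bin2_sqr m.
wlog ab : a b H Ef / a <= b.
  move=> W; have [|/ltnW] := leqP a b; first exact: W.
  by apply: W; rewrite ?[b + a]addnC // mulnC.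
have [d Ed] : exists d, b = a + d by exists (b - a); lia.
have [j0|j0] := posnP (c * l).
  exists d; rewrite j0 addn0 in Ef.
  have [s Es] : exists s, m = a + b + s by exists (m - a - b); lia.
  have [s0|s0] := posnP s; first by clear -Ed Ef E Em Es s0; subst b s m; nia.
  exfalso; have F : 4 * f + d ^ 2 = (a + b) ^ 2 by clear -Ed Ef; subst; nia.
  have G : 4 * f + m = m ^ 2 by clear -E Em; lia.
  have [s' Es'] : exists s', s = s' + 1 by exists (s - 1); clear -s0; lia.
  have [y Ey] : exists y, y = a + b by exists (a + b).
  rewrite -Ey in F Es; clear -F G Es Es' m5; subst m s.
  have: 4 * f <= y ^ 2 by clear -F; lia.
  by clear -m5 G; nia.
have Ec : c = 1 by clear -c1 j0; case: c c1 j0 => [|[|]].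
subst c; exfalso; rewrite mul1n in Ef j0.
have [s Es] : exists s, m = a + b + l + 1 + s by exists (m - a - b - l - 1); lia.
have F : 4 * a * b + d ^ 2 = (a + b) ^ 2 by clear -Ed; subst; nia.
have [y Ey] : exists y, y = a + b by exists (a + b).
rewrite -Ey in F Es.
have F' : 4 * f <= y ^ 2 + 4 * l by clear -F Ef; nia.
have G : 4 * f + m = m ^ 2 by clear -E Em; lia.
clear -F' G m5 j0 Es.
have [l' El] : exists l', l = l' + 1 by exists (l - 1); lia.
by subst; nia.
Qed.

Lemma no_large_critical (m f : nat) : 19 <= m -> 2 * f = 'C(m, 2) ->
  (exists k, f = 'C(k, 2)) -> ~ bipartite_star_size m f.
Proof.
move=> m19 E [k Ek] B; have m5 : 5 <= m by clear -m19; lia.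
have [v Ev] := half_pair_bipartite m5 E B.
suff : v <= 2 by clear -m19 Ev; nia.
apply: (@square_pronic_half v k).
have := bin2_sqr m; have := bin2_sqr k; rewrite -E -Ek => H H'.
by rewrite (expnM v 2 2) -Ev; clear -H H'; lia.
Qed.

(** * Edge counts as sums over ordered pairs *)

Definition adj (V : finType) (G : {set {set V}}) : rel V :=
  fun i j => (i != j) && ([set i; j]%SET \in G).

(** Counting ordered pairs costs a factor 2, but lets sums of products of class indicators factor
    into products of class sizes. *)
Definition pair_sum (V : finType) (r : rel V) (U : {set V}) : nat :=
  \sum_(i in U) \sum_(j in U) r i j.

Definition edges (V : finType) (r : rel V) : {set {set V}} :=
  [set a | [exists i, exists j, [&& i != j, r i j & a == [set i; j]%SET]]]%SET.

Lemma adj_sym (V : finType) (G : {set {set V}}) : symmetric (adj G).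
Proof. by move=> i j; rewrite /adj eq_sym finset.setUC. Qed.

Lemma adj_irr (V : finType) (G : {set {set V}}) : irreflexive (adj G).
Proof. by move=> i; rewrite /adj eqxx. Qed.

Lemma card_ordered_pairs (V : finType) (a U : {set V}) : #|a| = 2 -> a \subset U ->
  \sum_(i in U) \sum_(j in U) ((i != j) && ([set i; j]%SET == a)) = 2.
Proof.
move=> /eqP/cards2P[x [y [xy ->]]] /fintype.subsetP aU.
have xU : x \in U by apply: aU; rewrite !inE eqxx.
have yU : y \in U by apply: aU; rewrite !inE eqxx orbT.
have Ey : \sum_(j in U) ((x != j) && ([set x; j] == [set x; y])%SET) = 1.
  rewrite (bigD1 y) //= xy eqxx big1 // => j /andP[_ jy].
  have [->|xj] /= := eqVneq x j; first by [].
  case: eqP => // /setP/(_ j); rewrite !inE eqxx orbT (negbTE jy) orbF.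
  by rewrite eq_sym (negbTE xj).
have Ex : \sum_(j in U) ((y != j) && ([set y; j] == [set x; y])%SET) = 1.
  rewrite (bigD1 x) //= eq_sym xy finset.setUC eqxx big1 // => j /andP[_ jx].
  have [->|yj] /= := eqVneq y j; first by [].
  case: eqP => // /setP/(_ j); rewrite !inE eqxx orbT (negbTE jx).
  by rewrite eq_sym (negbTE yj).
rewrite (bigD1 x) //= Ey (bigD1 y) /= ?yU 1?eq_sym // Ex big1 // => i /andP[/andP[_ ix] iy].
rewrite big1 // => j _; case: andP => // -[_ /eqP/setP/(_ i)].
by rewrite !inE eqxx (negbTE ix) (negbTE iy).
Qed.

Lemma pair_sum_adj (V : finType) (G : {set {set V}}) (U : {set V}) :
  simple_graph G -> pair_sum (adj G) U = 2 * #|induced G U|.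
Proof.
move=> /'forall_implyP sG; rewrite mulnC -sum_nat_const.
have -> : \sum_(a in induced G U) 2 = \sum_(a in induced G U)
    \sum_(i in U) \sum_(j in U) ((i != j) && ([set i; j]%SET == a)).
  apply: eq_bigr => a; rewrite inE => /andP[/sG/eqP a2 aU].
  by rewrite card_ordered_pairs.
rewrite exchange_big; apply: eq_bigr => i iU.
rewrite exchange_big; apply: eq_bigr => j jU; rewrite /adj.
have [->|ij] /= := eqVneq i j; first by rewrite big1.
have sU : ([set i; j] \subset U)%SET.
  by apply/fintype.subsetP => x; rewrite !inE => /orP[] /eqP->.
have [ijG|ijG] := boolP ([set i; j]%SET \in G).
  rewrite (bigD1 [set i; j]%SET) ?inE ?ijG //= eqxx big1 // => a /andP[_ aij].
  by rewrite eq_sym (negbTE aij).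
rewrite big1 // => a; rewrite inE => /andP[aG _]; case: eqP => // Ea.
by rewrite Ea aG in ijG.
Qed.

Lemma edges_simple (V : finType) (r : rel V) : simple_graph (edges r).
Proof.
apply/'forall_implyP => a; rewrite inE => /existsP[i /existsP[j /and3P[ij _ /eqP->]]].
by rewrite cards2 ij.
Qed.

Lemma adj_edges (V : finType) (r : rel V) : symmetric r -> irreflexive r ->
  adj (edges r) =2 r.
Proof.
move=> rs ri i j; rewrite /adj inE; have [->|ij] /= := eqVneq i j; first by rewrite ri.
apply/existsP/idP => [[x /existsP[y /and3P[xy rxy /eqP/setP E]]]|rij]; last first.
  by exists i; apply/existsP; exists j; rewrite ij rij eqxx.
have := E x; have := E y; rewrite !inE !eqxx orbT /=.
move=> /orP[]/eqP Ey /orP[]/eqP Ex; subst => //.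
- by rewrite eqxx in xy.
- by rewrite rs.
- by rewrite eqxx in xy.
Qed.

Lemma not_arrow (n e m f : nat) (r : rel 'I_n) : symmetric r -> irreflexive r ->
  pair_sum r [set: 'I_n]%SET = 2 * e ->
  (forall U : {set 'I_n}, #|U| = m -> pair_sum r U <> 2 * f) -> ~~ arrow n e m f.
Proof.
move=> rs ri Ee H; rewrite negb_forall; apply/existsP; exists (edges r).
have S := edges_simple r.
have E U : 2 * #|induced (edges r) U| = pair_sum r U.
  by rewrite -pair_sum_adj //; apply: eq_bigr => i _; apply: eq_bigr => j _; rewrite adj_edges.
rewrite negb_imply S /=; apply/andP; split.
  have Ei : induced (edges r) [set: 'I_n]%SET = edges r.
    by apply/setP => a; rewrite inE finset.subsetT andbT.
  by rewrite -(eqn_pmul2l (isT : 0 < 2)) -Ee -E Ei.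
apply/negP => /existsP[U /andP[/eqP Um /eqP Uf]].
by apply: (H U Um); rewrite -E Uf.
Qed.

Lemma arrowP (n e m f : nat) (G : {set {set 'I_n}}) : arrow n e m f -> simple_graph G ->
  #|G| = e -> exists2 U : {set 'I_n}, #|U| = m & #|induced G U| = f.
Proof.
move=> /forallP/(_ G)/implyP H sG eG.
have /existsP[U /andP[/eqP Um /eqP Uf]] : [exists U : {set 'I_n}, (#|U| == m) && (#|induced G U| == f)].
  by apply: H; rewrite sG eG eqxx.
by exists U.
Qed.

Definition cograph (V : finType) (G : {set {set V}}) : {set {set V}} :=
  [set a : {set V} | (#|a| == 2) && (a \notin G)]%SET.

Lemma card_induced_cograph (V : finType) (G : {set {set V}}) (U : {set V}) :
  simple_graph G -> #|induced G U| + #|induced (cograph G) U| = 'C(#|U|, 2).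
Proof.
move=> /'forall_implyP sG; rewrite -cards_draws -[RHS](cardsID G); congr (_ + _).
  apply: eq_card => a; rewrite !inE; have [/sG/eqP->|] := boolP (a \in G); last by rewrite andbF.
  by rewrite eqxx !andbT.
by apply: eq_card => a; rewrite !inE; case: (a \in G); case: (_ == 2); case: (_ \subset _).
Qed.

Lemma induced_setT (V : finType) (G : {set {set V}}) : induced G [set: V]%SET = G.
Proof. by apply/setP => a; rewrite inE finset.subsetT andbT. Qed.

Lemma cograph_simple (V : finType) (G : {set {set V}}) : simple_graph (cograph G).
Proof. by apply/'forall_implyP => a; rewrite inE => /andP[]. Qed.

Lemma arrow_cograph (n e m f : nat) : e <= 'C(n, 2) -> f <= 'C(m, 2) ->
  arrow n e m f -> arrow n ('C(n, 2) - e) m ('C(m, 2) - f).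
Proof.
move=> en fm A; apply/forallP => G; apply/implyP => /andP[sG /eqP eG].
have eC : #|cograph G| = e.
  have := card_induced_cograph [set: 'I_n]%SET sG.
  by rewrite !induced_setT cardsT card_ord eG; lia.
have [U Um Uf] := arrowP A (cograph_simple G) eC.
apply/existsP; exists U; rewrite Um eqxx /=.
by have := card_induced_cograph U sG; rewrite Um Uf => <-; rewrite addnK.
Qed.

(** * Graph families *)

Lemma sum_interval (n lo hi : nat) :
  \sum_(i < n) ((lo <= i) && (i < hi)) = minn hi n - lo.
Proof.
elim: n => [|n IH]; first by rewrite big_ord0; lia.
by rewrite big_ord_recr /= IH; lia.
Qed.

Lemma sum_setT (V : finType) (A : V -> nat) : \sum_(i in [set: V]%SET) A i = \sum_i A i.
Proof. by apply: eq_bigl => i; rewrite inE. Qed.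

Lemma sum_diag (V : finType) (U : {set V}) (A : V -> nat) :
  \sum_(i in U) \sum_(j in U) (i == j) * A i = \sum_(i in U) A i.
Proof.
apply: eq_bigr => i iU; rewrite (bigD1 i) //= eqxx mul1n big1 ?addn0 // => j /andP[_ ji].
by rewrite eq_sym (negbTE ji).
Qed.

Lemma sum_le_card (V : finType) (U : {set V}) (A : V -> nat) :
  (forall i, A i <= 1) -> \sum_(i in U) A i <= #|U|.
Proof. by move=> H; rewrite -sum1_card; apply: leq_sum. Qed.

Lemma sum_le_setT (V : finType) (U : {set V}) (A : V -> nat) :
  \sum_(i in U) A i <= \sum_i A i.
Proof. by rewrite [leqRHS](bigID (mem U)) /= leq_addr. Qed.

Lemma clique_star_excluded (n x l m f : nat) : x + 1 + l <= n ->
  ~ clique_star_size m f -> ~~ arrow n ('C(x, 2) + l) m f.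
Proof.
move=> xn nf.
pose A (i : 'I_n) := (0 <= i) && (i < x).
pose S (i : 'I_n) := (x <= i) && (i < x.+1).
pose L (i : 'I_n) := (x.+1 <= i) && (i < x + 1 + l).
pose r : rel 'I_n := fun i j => [|| [&& i != j, A i & A j], S i && L j | L i && S j].
(* Adding the diagonal turns the clique into the full square of [A], so that every term is a
   product. *)
have rE i j : r i j + (i == j) * A i = A i * A j + (S i * L j + L i * S j).
  by rewrite /r /A /S /L -val_eqE /=; lia.
have sumE (U : {set 'I_n}) : pair_sum r U + \sum_(i in U) A i = (\sum_(i in U) A i) ^ 2 +
    2 * ((\sum_(i in U) S i) * (\sum_(i in U) L i)).
  rewrite -{1}(sum_diag U (fun i => A i : nat)) /pair_sum -big_split /=.
  under eq_bigr => i _ do rewrite -big_split /=.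
  under eq_bigr => i _ do under eq_bigr => j _ do rewrite rE.
  under eq_bigr => i _ do rewrite !big_split /=.
  rewrite !big_split /= -!big_distrlr /= -mulnn mul2n -addnn.
  by congr (_ + (_ + _)); rewrite mulnC.
apply: (@not_arrow _ _ _ _ r).
- by move=> i j; rewrite /r eq_sym; lia.
- by move=> i; rewrite /r eqxx /A /S /L; lia.
- have := sumE [set: 'I_n]%SET; rewrite !sum_setT /= !sum_interval.
  have [-> -> ->] : [/\ minn x n - 0 = x, minn x.+1 n - x = 1 & minn (x + 1 + l) n - x.+1 = l].
    by split; lia.
  by have := bin2_sqr x; clear; lia.
move=> U Um Uf; apply: nf; have := sumE U; rewrite Uf.
set a := \sum_(i in U) A i; set s := \sum_(i in U) S i; set t := \sum_(i in U) L i => E.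
exists a, s, t; split.
- rewrite -!big_split /= -Um; apply: sum_le_card => i.
  by rewrite /A /S /L; lia.
- by apply: leq_trans (sum_le_setT _ _) _; rewrite sum_interval; lia.
- by have := bin2_sqr a; clear -E; lia.
Qed.

Lemma clique_matching_excluded (n x u m f : nat) : x <= n -> 2 * u <= x ->
  ~ clique_matching_size m f -> ~~ arrow n ('C(x, 2) - u) m f.
Proof.
move=> xn ux nf.
pose A (i : 'I_n) := (0 <= i) && (i < x).
(* The matching consists of the pairs [2 j, 2 j + 1] with [j < u]. *)
pose p (i : nat) := if odd i then i.-1 else i.+1.
pose M (i j : 'I_n) := (i < 2 * u) && ((p i <= j) && (j < (p i).+1)).
pose r : rel 'I_n := fun i j => [&& i != j, A i, A j & ~~ M i j].
have rE i j : r i j + M i j + (i == j) * A i = A i * A j.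
  by rewrite /r /A /M /p -val_eqE /=; case: ifP; lia.
have sumM (i : 'I_n) : \sum_(j < n) M i j = (i < 2 * u).
  rewrite /M; case: ltnP => iu /=; last by rewrite big1.
  by rewrite sum_interval; rewrite /p; case: ifP; lia.
have sumE (U : {set 'I_n}) : pair_sum r U + \sum_(i in U) \sum_(j in U) M i j + \sum_(i in U) A i =
    (\sum_(i in U) A i) ^ 2.
  rewrite -{1}(sum_diag U (fun i => A i : nat)) /pair_sum -!big_split /=.
  under eq_bigr => i _ do rewrite -!big_split /=.
  under eq_bigr => i _ do under eq_bigr => j _ do rewrite rE.
  by rewrite -big_distrlr /= -mulnn.
apply: (@not_arrow _ _ _ _ r).
- by move=> i j; rewrite /r /M /p eq_sym; case: ifP; case: ifP; lia.
- by move=> i; rewrite /r eqxx.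
- have := sumE [set: 'I_n]%SET; rewrite !sum_setT /= !sum_interval.
  have -> : minn x n - 0 = x by lia.
  under eq_bigr => i _ do rewrite sum_setT sumM.
  have -> : \sum_(i < n) (i < 2 * u) = 2 * u.
    by transitivity (minn (2 * u) n - 0); [exact: (sum_interval n 0 (2 * u)) | lia].
  by have := bin2_sqr x => <-; clear -ux; lia.
move=> U Um Uf; apply: nf; have := sumE U; rewrite Uf.
set k := \sum_(i in U) A i => E.
(* Every clique vertex has at most one partner. The sum counts ordered pairs, so it equals
   [2 ('C(k, 2) - f)]. *)
have Mk : \sum_(i in U) \sum_(j in U) M i j <= k.
  apply: leq_sum => i _; apply: leq_trans (sum_le_setT _ _) _.
  by rewrite sumM /A; lia.
move: Mk E; set mu := \sum_(i in U) _ => Mk E; have Ek := bin2_sqr k.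
exists k, ('C(k, 2) - f); split; last by lia.
- by rewrite -Um; apply: sum_le_card => i; case: (A i).
- by lia.
Qed.

Definition itv (n lo hi : nat) (i : 'I_n) : bool := (lo <= i) && (i < hi).

(** Four consecutive intervals of vertices: the sides of sizes [p] and [q], the centre [p + q], and
    [l] leaves. *)
Definition bipartite_star (n p q l : nat) : rel 'I_n := fun i j =>
  [|| itv 0 p i && itv p (p + q) j, itv p (p + q) i && itv 0 p j,
      itv (p + q) (p + q).+1 i && itv (p + q).+1 (p + q + 1 + l) j
    | itv (p + q).+1 (p + q + 1 + l) i && itv (p + q) (p + q).+1 j].

Lemma bipartite_star_sym (n p q l : nat) : symmetric (@bipartite_star n p q l).
Proof.
move=> i j; rewrite /bipartite_star.
by rewrite orbCA !(andbC (itv _ _ j)); congr [|| _, _ | _]; rewrite orbC.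
Qed.

Lemma bipartite_star_irr (n p q l : nat) : irreflexive (@bipartite_star n p q l).
Proof. by move=> i; rewrite /bipartite_star /itv; lia. Qed.

Lemma pair_sum_bipartite_starE (n p q l : nat) (U : {set 'I_n}) :
  pair_sum (@bipartite_star n p q l) U =
  2 * ((\sum_(i in U) itv 0 p i) * (\sum_(i in U) itv p (p + q) i) +
       (\sum_(i in U) itv (p + q) (p + q).+1 i) *
       (\sum_(i in U) itv (p + q).+1 (p + q + 1 + l) i)).
Proof.
set A : 'I_n -> bool := itv 0 p; set B : 'I_n -> bool := itv p (p + q).
set S : 'I_n -> bool := itv (p + q) (p + q).+1.
set L : 'I_n -> bool := itv (p + q).+1 (p + q + 1 + l).
have rE i j : bipartite_star p q l i j = A i * B j + B i * A j + (S i * L j + L i * S j) :> nat.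
  have AB x : A x -> B x = false by rewrite /A /B /itv; lia.
  have AS x : A x -> S x = false by rewrite /A /S /itv; lia.
  have AL x : A x -> L x = false by rewrite /A /L /itv; lia.
  have BS x : B x -> S x = false by rewrite /B /S /itv; lia.
  have BL x : B x -> L x = false by rewrite /B /L /itv; lia.
  have SL x : S x -> L x = false by rewrite /S /L /itv; lia.
  rewrite /bipartite_star -/A -/B -/S -/L.
  have [Ai|] := boolP (A i); first by rewrite (AB i Ai) (AS i Ai) (AL i Ai) /=; case: (B j).
  have [Bi|] := boolP (B i); first by rewrite (BS i Bi) (BL i Bi) /=; case: (A j).
  by have [Si|] := boolP (S i); [rewrite (SL i Si) /= | case: (L i)]; case: (L j); case: (S j).
rewrite /pair_sum.
under eq_bigr => i _ do under eq_bigr => j _ do rewrite rE.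
under eq_bigr => i _ do rewrite !big_split /=.
rewrite !big_split /= -!big_distrlr /= mulnDr !mul2n -!addnn.
by congr (_ + _ + (_ + _)); rewrite mulnC.
Qed.

Lemma pair_sum_bipartite_star (n p q l : nat) (U : {set 'I_n}) : exists a b c d,
  [/\ a + b + c + d <= #|U|, c <= 1 & pair_sum (@bipartite_star n p q l) U = 2 * (a * b + c * d)].
Proof.
rewrite pair_sum_bipartite_starE; do 4 eexists; split; last reflexivity.
- by rewrite -!big_split /=; apply: sum_le_card => i; rewrite /itv; lia.
- by apply: leq_trans (sum_le_setT _ _) _; rewrite sum_interval; lia.
Qed.

(** The summand [(0 < l)] asks for a centre only when there are leaves; for [l = 0] the two sides
    may fill all [n] vertices. *)
Lemma pair_sum_bipartite_starT (n p q l : nat) : p + q + (0 < l) + l <= n ->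
  pair_sum (@bipartite_star n p q l) [set: 'I_n]%SET = 2 * (p * q + l).
Proof.
move=> pn; rewrite pair_sum_bipartite_starE !sum_setT !sum_interval; congr (2 * _).
congr (_ + _); first by congr (_ * _); lia.
by case: l pn => [|l] pn; [rewrite [X in _ * X](_ : _ = 0) ?muln0 | rewrite [X in X * _](_ : _ = 1) ?mul1n]; lia.
Qed.

Lemma bipartite_star_excluded (n p q l m f : nat) : p + q + 1 + l <= n ->
  ~ bipartite_star_size m f -> ~~ arrow n (p * q + l) m f.
Proof.
move=> pn nf; apply: (@not_arrow _ _ _ _ (@bipartite_star n p q l)).
- exact: bipartite_star_sym.
- exact: bipartite_star_irr.
- by apply: pair_sum_bipartite_starT; lia.
move=> U Um; have [a [b [c [d [H c1 ->]]]]] := pair_sum_bipartite_star p q l U => E.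
by apply: nf; exists a, b, c, d; rewrite -Um; split=> //; lia.
Qed.

(** Any [e] edges of the balanced complete bipartite graph form a graph whose [m]-vertex induced
    subgraphs have at most [m^2 / 4] edges, by the inequality of arithmetic and geometric means. *)
Lemma bipartite_excluded (n e m f : nat) : e <= n./2 * uphalf n ->
  m ^ 2 < 4 * f -> ~~ arrow n e m f.
Proof.
move=> en mf; apply/negP => A.
set r := @bipartite_star n n./2 (uphalf n) 0.
have rs := @bipartite_star_sym n n./2 (uphalf n) 0.
have ri := @bipartite_star_irr n n./2 (uphalf n) 0.
have E U : 2 * #|induced (edges r) U| = pair_sum r U.
  rewrite -pair_sum_adj ?edges_simple //.
  by apply: eq_bigr => i _; apply: eq_bigr => j _; rewrite adj_edges.
have cK : e <= #|edges r|.
  have := E [set: 'I_n]%SET; rewrite induced_setT pair_sum_bipartite_starT; lia.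
have [s [us ss sK]] := card_geqP cK.
have [U Um Uf] : exists2 U : {set 'I_n}, #|U| = m & #|induced [set:: s]%SET U| = f.
  apply: arrowP A _ _; last by rewrite cardsE (card_uniqP us).
  apply/'forall_implyP => a; rewrite inE => /sK.
  by have /'forall_implyP := edges_simple r; apply.
have: #|induced [set:: s]%SET U| <= #|induced (edges r) U|.
  apply: subset_leq_card; apply/fintype.subsetP => a; rewrite !inE => /andP[/sK + ->].
  by rewrite inE andbT.
have [a [b [c [d [H c1 E']]]]] := pair_sum_bipartite_star n./2 (uphalf n) 0 U.
have := E U; rewrite Uf E' => E1 E2.
have F : f <= a * b + c * d by clear -E1 E2; lia.
have: 4 * (a * b) <= (a + b) ^ 2 by rewrite nat_AGM2.
have: 4 * (c * d) <= (c + d) ^ 2 by rewrite nat_AGM2.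
have: (a + b) ^ 2 + (c + d) ^ 2 <= (a + b + c + d) ^ 2 by clear; nia.
have: (a + b + c + d) ^ 2 <= m ^ 2 by rewrite leq_exp2r // -Um.
by clear -F mf; lia.
Qed.

(* Disjoint unions of cliques, i.e. the graphs without an induced path on three
   vertices. *)
Definition clique_union (n e : nat) : Prop := exists r : rel 'I_n,
  [/\ symmetric r, irreflexive r, forall i j k, i != k -> r i j -> r j k -> r i k
    & pair_sum r [set: 'I_n]%SET = 2 * e].

Lemma clique_union_add (n e k : nat) : clique_union n e -> clique_union (n + k) (e + 'C(k, 2)).
Proof.
move=> [r [rs ri rt Ee]].
pose r' : rel 'I_(n + k) := fun i j => match fintype.split i, fintype.split j with
  | inl x, inl y => r x y | inr x, inr y => x != y | _, _ => false end.
have spl (i : 'I_n) : fintype.split (lshift k i) = inl i by rewrite -(unsplitK (inl i)).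
have spr (i : 'I_k) : fintype.split (rshift n i) = inr i by rewrite -(unsplitK (inr i)).
exists r'; split.
- by move=> i j; rewrite /r'; case: (fintype.split i) => x; case: (fintype.split j) => y //; rewrite eq_sym.
- by move=> i; rewrite /r'; case: (fintype.split i) => x; rewrite ?ri ?eqxx.
- move=> i j l; rewrite /r' -(inj_eq (can_inj (@splitK n k))).
  case: (fintype.split i) => x; case: (fintype.split j) => y //; case: (fintype.split l) => z //.
  by move=> xz; apply: rt.
- rewrite /pair_sum sum_setT; under eq_bigr => i _ do rewrite sum_setT.
  rewrite big_split_ord /=.
  under eq_bigr => i _ do rewrite big_split_ord /=.
  under [X in _ + X]eq_bigr => i _ do rewrite big_split_ord /=.
  rewrite mulnDr -Ee /pair_sum sum_setT; congr (_ + _).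
    apply: eq_bigr => i _; rewrite sum_setT [X in _ + X]big1 ?addn0 => [|j _].
      by apply: eq_bigr => j _; rewrite /r' !spl.
    by rewrite /r' spl spr.
  have Ei (i : 'I_k) : \sum_(j < n) r' (rshift n i) (lshift k j) +
      \sum_(j < k) r' (rshift n i) (rshift n j) + 1 = k.
    rewrite big1 => [|j _]; last by rewrite /r' spl spr.
    rewrite add0n (bigD1 i) //= /r' !spr eqxx /=.
    under eq_bigr => j ji do rewrite !spr eq_sym ji.
    by rewrite sum1_card cardC1 card_ord; have := ltn_ord i; lia.
  have: \sum_(i < k) (\sum_(j < n) r' (rshift n i) (lshift k j) +
      \sum_(j < k) r' (rshift n i) (rshift n j) + 1) = k ^ 2.
    under eq_bigr => i _ do rewrite Ei.
    by rewrite sum_nat_const card_ord.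
  by rewrite big_split /= sum_nat_const card_ord; have := bin2_sqr k; lia.
Qed.

Lemma clique_union0 : clique_union 0 0.
Proof.
exists (fun _ _ => false); split=> //.
by rewrite /pair_sum big1 // => -[].
Qed.

(** A star contains induced paths, so the [l] extra edges come from [l %/ 3] triangles and [l %% 3]
    single edges. These use [l + l %% 3] vertices, hence the 2 spare ones. *)
Lemma clique_union_triangles (n x l : nat) : x + l + 2 <= n -> clique_union n ('C(x, 2) + l).
Proof.
move=> xn.
have step (k j m e : nat) : clique_union m e -> clique_union (m + j * k) (e + j * 'C(k, 2)).
  elim: j => [|j IH] H; first by rewrite !addn0.
  by rewrite !mulSn ![k + _]addnC ![_ + j * _]addnC !addnA; apply: clique_union_add; apply: IH.
have tr a b : clique_union a b -> a = n -> b = 'C(x, 2) + l -> clique_union n ('C(x, 2) + l).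
  by move=> + <- <-.
apply: (tr _ _ (step 1 (n - (x + l %/ 3 * 3 + l %% 3 * 2)) _ _
  (step 2 (l %% 3) _ _ (step 3 (l %/ 3) _ _ (@clique_union_add 0 0 x clique_union0))))).
  by lia.
rewrite (_ : 'C(1, 2) = 0) // (_ : 'C(2, 2) = 1) // (_ : 'C(3, 2) = 3) //.
by clear; lia.
Qed.

Lemma clique_union_excluded (n e : nat) : clique_union n e -> ~~ arrow n e 3 2.
Proof.
move=> [r [rs ri rt Ee]]; apply: (@not_arrow _ _ _ _ r) => // U U3.
have /card_gt0P[a aU] : 0 < #|U| by rewrite U3.
have /eqP/cards2P[b [c [bc Ebc]]] : #|U :\ a|%SET = 2 by move: U3; rewrite (cardsD1 a) aU => -[].
have ab : a != b.
  by apply: contraTneq (_ : b \in U :\ a)%SET => [->|]; rewrite ?Ebc !inE ?eqxx // .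
have ac : a != c.
  by apply: contraTneq (_ : c \in U :\ a)%SET => [->|]; rewrite ?Ebc !inE ?eqxx ?orbT // .
rewrite -(finset.setD1K aU) Ebc /pair_sum.
have aN : a \notin [set b; c]%SET by rewrite !inE negb_or ab.
have bN : b \notin [set c]%SET by rewrite !inE.
rewrite !big_setU1 //= !big_set1 !big_setU1 //= !big_set1 !ri (rs b a) (rs c a) (rs c b).
have := rt a b c ac; have := rt b a c bc; have := rt a c b ab.
rewrite (rs b a) (rs c b); case: (r a b); case: (r a c); case: (r b c) => //= H1 H2 H3.
- by have := H2 isT isT.
- by have := H3 isT isT.
- by have := H1 isT isT.
Qed.

(** * Counting excluded sizes *)

Definition excluded (n m f : nat) : nat :=
  \sum_(0 <= e < 'C(n, 2).+1) ~~ arrow n e m f.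

Lemma card_S_excluded (n m f : nat) : #|S_ n m f| + excluded n m f = 'C(n, 2).+1.
Proof.
rewrite /excluded big_mkord -sum1_card (eq_bigl (fun e : 'I_('C(n, 2).+1) => arrow n e m f)); last first.
  by move=> e; rewrite inE.
rewrite big_mkcond /= -big_split /= -[RHS]card_ord -sum1_card.
by apply: eq_bigr => e _; case: arrow.
Qed.

Lemma count_intervals (P : pred nat) (b h : nat -> nat) (N : nat) :
  (forall x, x < N -> b x + h x <= b x.+1) ->
  (forall x l, x < N -> l < h x -> P (b x + l)) ->
  \sum_(0 <= x < N) h x <= \sum_(0 <= e < b N) P e.
Proof.
elim: N => [|N IH] Hb HP; first by rewrite big_geq.
rewrite big_nat_recr //=.
have bN := Hb N (ltnSn N).
have bN' : b N <= b N.+1 by apply: leq_trans bN; rewrite leq_addr.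
rewrite [leqRHS](big_cat_nat (leq0n (b N)) bN') /=.
apply: leq_add; first by apply: IH => [x xN|x l xN]; [apply: Hb | apply: HP]; rewrite ltnS ltnW.
rewrite (big_cat_nat (leq_addr _ _) bN) /=; apply: leq_trans (leq_addr _ _).
rewrite [leqLHS](_ : _ = \sum_(b N <= i < b N + h N) 1); last by rewrite sum_nat_const_nat muln1 addKn.
rewrite big_nat_cond [leqRHS]big_nat_cond; apply: leq_sum => i; rewrite andbT => /andP[bi ih].
by rewrite -(subnKC bi) HP //; lia.
Qed.

Lemma sum_nat_le (P : nat -> nat) (a b : nat) : a <= b ->
  \sum_(0 <= e < a) P e <= \sum_(0 <= e < b) P e.
Proof. by move=> ab; rewrite (big_cat_nat (leq0n a) ab) /= leq_addr. Qed.

(** The first [B] arguments and their mirror images are disjoint, as [2 * B <= C.+1]. This serves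
    self-complementary exclusion, where [2 f = 'C(m, 2)]. *)
Lemma sum_reflect (P : nat -> nat) (B C : nat) : 2 * B <= C.+1 ->
  (forall e, e <= C -> P (C - e) = P e) ->
  2 * (\sum_(0 <= e < B) P e) <= \sum_(0 <= e < C.+1) P e.
Proof.
move=> BC H; rewrite mul2n -addnn [leqRHS](big_cat_nat (leq0n (C.+1 - B)) (leq_subr _ _)) /=.
apply: leq_add; first by apply: sum_nat_le; lia.
rewrite [leqRHS]big_nat_rev /= (_ : C.+1 - B = 0 + (C.+1 - B)) // big_addn.
rewrite (_ : C.+1 - (C.+1 - B) = B); last by lia.
rewrite big_nat_cond [leqRHS]big_nat_cond; apply: leq_sum => i; rewrite andbT => /andP[_ iB].
by rewrite -(H i); [apply: eq_leq; congr P | ]; lia.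
Qed.

(** Passing from [N] to [N + 2] adds a 1 at both ends and raises the other [N] terms by one. *)
Lemma sum_min_sqr (N : nat) : N.+1 ^ 2 <= 4 * (\sum_(0 <= x < N) minn x.+1 (N - x)) + 1.
Proof.
elim/ltn_ind: N => -[|[|N]] IH; [by rewrite big_geq | by rewrite big_nat1 | ].
rewrite big_nat_recl // big_nat_recr //=.
have -> : \sum_(0 <= i < N) minn i.+2 (N.+2 - i.+1) = \sum_(0 <= x < N) (minn x.+1 (N - x) + 1).
  rewrite big_nat_cond [RHS]big_nat_cond; apply: eq_bigr => i; rewrite andbT => /andP[_ iN].
  by lia.
rewrite big_split /= sum_nat_const_nat.
by have := IH N; nia.
Qed.

(** Passing from [n] to [n + 3] adds the terms 0, 1, 1 and raises the other [n] by one. The slopes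
    1/2 and 1 meet near [y = 2 n / 3] at height [n / 3], whence [n^2 / 6]. *)
Lemma sum_min_half_sqr (n : nat) :
  n ^ 2 <= 6 * (\sum_(0 <= y < n) minn (uphalf y) (n - y)) + 1.
Proof.
elim/ltn_ind: n => -[|[|[|n]]] IH;
  [by rewrite big_geq | by rewrite big_nat1 | by rewrite unlock | ].
rewrite big_nat_recl // big_nat_recl // big_nat_recr //=.
have -> : \sum_(0 <= i < n) minn (uphalf i.+2) (n.+3 - i.+2) =
    \sum_(0 <= y < n) (minn (uphalf y) (n - y) + 1).
  rewrite big_nat_cond [RHS]big_nat_cond; apply: eq_bigr => i; rewrite andbT => /andP[_ iN].
  by lia.
rewrite big_split /= sum_nat_const_nat.
by have := IH n; nia.
Qed.

Lemma excluded_ge_sum (n m f N : nat) (b h : nat -> nat) :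
  b N <= 'C(n, 2).+1 -> (forall x, x < N -> b x + h x <= b x.+1) ->
  (forall x l, x < N -> l < h x -> ~~ arrow n (b x + l) m f) ->
  \sum_(0 <= x < N) h x <= excluded n m f.
Proof.
move=> bN Hb HP; apply: leq_trans (sum_nat_le _ bN).
exact: (@count_intervals (fun e => ~~ arrow n e m f)).
Qed.

Lemma half_uphalf_sqr (n : nat) :
  4 * (n./2 * uphalf n) <= n ^ 2 <= 4 * (n./2 * uphalf n) + 1.
Proof.
have: n = n./2 + uphalf n by lia.
have: uphalf n = n./2 \/ uphalf n = n./2 + 1 by lia.
by move: (n./2) (uphalf n) => p q; clear; case=> -> ->; nia.
Qed.

Lemma excluded_bipartite (n m f : nat) : m ^ 2 < 4 * f -> n ^ 2 <= 4 * excluded n m f + 1.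
Proof.
move=> mf; suff: n./2 * uphalf n <= excluded n m f.
  by have /andP[_] := half_uphalf_sqr n; clear; lia.
have [n2|n2] := leqP n 1; first by case: n n2 => [|[|]].
have := @excluded_ge_sum n m f 1 (fun x => x * (n./2 * uphalf n)) (fun=> n./2 * uphalf n).
rewrite big_nat1; apply.
- rewrite mul1n; have /andP[+ _] := half_uphalf_sqr n; have := bin2_sqr n.
  by clear -n2; nia.
- by move=> x; rewrite mulSn addnC.
by move=> [|//] l _ ll; apply: bipartite_excluded => //; lia.
Qed.

Lemma excluded_clique_star (n m f : nat) : ~ clique_star_size m f ->
  n ^ 2 <= 4 * excluded n m f + 1.
Proof.
move=> nf; case: n => // n; apply: leq_trans (sum_min_sqr n) _.
rewrite leq_add2r leq_mul2l /=.
apply: (@excluded_ge_sum _ _ _ n (fun x => 'C(x.+1, 2))) => //.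
- by move=> x xn; rewrite [leqRHS]binS bin1; lia.
- by move=> x l xn ll; apply: clique_star_excluded => //; lia.
Qed.

Lemma excluded_clique_union (n : nat) : n ^ 2 <= 4 * excluded n 3 2 + 2 * n + 1.
Proof.
case: n => [|[|n]]; [by lia | by lia | have := sum_min_sqr n].
suff : \sum_(0 <= x < n) minn x.+1 (n - x) <= excluded n.+2 3 2 by nia.
apply: (@excluded_ge_sum _ _ _ n (fun x => 'C(x.+1, 2))).
- by apply: leq_trans (leqnSn _); apply: leq_bin2l; lia.
- by move=> x xn; rewrite [leqRHS]binS bin1; lia.
- by move=> x l xn ll; apply: clique_union_excluded; apply: clique_union_triangles; lia.
Qed.

(** Deleting matchings from a clique on [p] vertices realises the [p./2 + 1] counts ending at
    ['C(p, 2)]. The cliques start at [p = 3], where [p./2 + 1 <= 'C(p, 2)] first holds. *)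
Lemma excluded_clique_matching (n m f : nat) : ~ clique_matching_size m f ->
  n ^ 2 <= 4 * excluded n m f + 9 * n + 9.
Proof.
move=> nf; case: n => [|[|[|n]]]; [by lia | by lia | by lia | ].
have: n.+3 ^ 2 <= 4 * (\sum_(0 <= x < n) (x.+3./2 + 1)) + 9 * n.+3 + 9.
  elim: n => [|n IH]; first by rewrite big_geq.
  rewrite big_nat_recr //=; move: (\sum_(0 <= x < n) _) IH => s IH.
  have: n.+3 <= 2 * uphalf n.+2 + 1 by lia.
  by nia.
suff: \sum_(0 <= x < n) (x.+3./2 + 1) <= excluded n.+3 m f by clear; lia.
have half x : x.+3./2 + 1 <= 'C(x.+3, 2).
  have := bin2_sqr x.+3; have: 2 * x.+3./2 <= x.+3 by lia.
  by move: (x.+3./2) ('C(x.+3, 2)) => p q; clear; nia.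
apply: (@excluded_ge_sum _ _ _ n (fun x => 'C(x.+3, 2) - x.+3./2)).
- by rewrite leqW // leq_subr.
- move=> x _; have E : 'C(x.+4, 2) = 'C(x.+3, 2) + x.+3 by rewrite binS bin1.
  by have := half x; have := half x.+1; rewrite E; clear; lia.
move=> x l xn ll.
have -> : 'C(x.+3, 2) - x.+3./2 + l = 'C(x.+3, 2) - (x.+3./2 - l).
  by have := half x; clear -ll; lia.
by apply: clique_matching_excluded => //; clear -xn; lia.
Qed.

Lemma excluded_cograph (n m f : nat) : f <= 'C(m, 2) ->
  excluded n m ('C(m, 2) - f) = excluded n m f.
Proof.
move=> fm; rewrite /excluded big_nat_rev /= big_nat_cond [RHS]big_nat_cond.
apply: eq_bigr => e; rewrite andbT => /andP[_ en]; rewrite add0n subSS; congr (nat_of_bool (~~ _)).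
have {}en : e <= 'C(n, 2) by [].
apply/idP/idP => [/(arrow_cograph (leq_subr _ _) (leq_subr _ _))|/arrow_cograph].
  by rewrite !subKn.
exact.
Qed.

(** Stars added to balanced bipartite graphs on [y] vertices cover about [n^2 / 6] counts in the
    lower half; complementation doubles this to [n^2 / 3], more than the required [n^2 / 4]. *)
Lemma excluded_half_bipartite (n m f : nat) : 2 * f = 'C(m, 2) ->
  ~ bipartite_star_size m f -> n ^ 2 <= 4 * excluded n m f + 2 * n + 1.
Proof.
move=> fm nf; case: n => [|n] //.
have := sum_min_half_sqr n; set s := \sum_(0 <= y < n) _ => Hs.
suff: 2 * s <= excluded n.+1 m f by move: Hs; clear; nia.
pose b x := x./2 * uphalf x.
have Hn : 2 * b n <= 'C(n.+1, 2).+1.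
  have := bin2_sqr n.+1; have /andP[+ _] := half_uphalf_sqr n; rewrite /b.
  by move: (_ * uphalf n) => p; clear; nia.
apply: leq_trans (sum_reflect Hn _); last first.
  move=> e en /=; congr (nat_of_bool (~~ _)).
  have ff : 'C(m, 2) - f = f by rewrite -fm; clear; lia.
  apply/idP/idP => [/(arrow_cograph (leq_subr _ _))|/(arrow_cograph en)].
    by rewrite subKn // ff; apply; rewrite -fm; clear; lia.
  by rewrite ff; apply; rewrite -fm; clear; lia.
rewrite leq_mul2l /=; apply: count_intervals.
  move=> x xn; rewrite /b.
  have: minn (uphalf x) (n - x) <= uphalf x by rewrite geq_minl.
  have: x./2 * uphalf x + uphalf x = x.+1./2 * uphalf x.+1 by rewrite /= -mulSnr mulnC.
  by clear; lia.
move=> x l xn ll; apply: bipartite_star_excluded => //; clear -xn ll; lia.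
Qed.

(** * The upper bound *)

Import Order.TTheory GRing.Theory Num.Theory.

Lemma limn_esup_ub (R : realType) (u : nat -> \bar R) (l : \bar R) (N : nat) :
  (forall n, N <= n -> (u n <= l)%E) -> (limn_esup u <= l)%E.
Proof.
move=> H; apply: (@le_trans _ _ (ereal_sup (u @` [set n | N <= n])%classic)).
  by apply: ereal_inf_lbound; exists [set n | N <= n]%classic => //; exists N.
by apply: ge_ereal_sup => _ [n /= Nn <-]; apply: H.
Qed.

Lemma limn_esup_lb (R : realType) (u : nat -> \bar R) (l : \bar R) (N : nat) :
  (forall n, N <= n -> (l <= u n)%E) -> (l <= limn_esup u)%E.
Proof.
move=> H; apply: le_ereal_inf_tmp => _ [A [k _ kA] <-].
apply: (@le_trans _ _ (u (maxn N k))); first by apply: H; rewrite leq_maxl.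
by apply: ereal_sup_ubound; exists (maxn N k) => //; apply: kA; rewrite /= leq_maxr.
Qed.

(** The conclusion is [s / C <= 1/2 + 1/D] cleared of denominators; the threshold on [n] absorbs the
    linear error terms into [1/D]. *)
Lemma half_density_arith (D c n s x C : nat) : s + x = C.+1 -> 2 * C + n = n ^ 2 ->
  n ^ 2 <= 4 * x + c * n + c -> 2 + 4 * D * (c + 4) <= n -> 2 * D * s <= (D + 2) * C.
Proof.
move=> E1 E2 E3 Hn.
have E4 : 4 * s + 2 * n <= n ^ 2 + c * n + c + 4 by lia.
have E5 : 4 * (2 * D * s) + 4 * D * n <= 2 * D * (n ^ 2 + c * n + c + 4) by nia.
have E6 : 4 * D * (c + 4) * (n + 1) <= n * (n + 1) by rewrite leq_mul2r; lia.
have E7 : 4 * ((D + 2) * C) + 2 * (D + 2) * n = 2 * (D + 2) * n ^ 2 by nia.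
suff: 4 * (2 * D * s) <= 4 * ((D + 2) * C) by rewrite leq_mul2l.
by clear -E5 E6 E7 Hn; nia.
Qed.

Lemma sigma_le_half (R : realType) (m f c : nat) :
  (forall n, n ^ 2 <= 4 * excluded n m f + c * n + c) -> (sigma R m f <= (1 / 2)%R%:E)%E.
Proof.
move=> H; apply/lee_addgt0Pr => eps eps0.
have [D HD] : exists D : nat, ((D.+1%:R : R)^-1 < eps)%R.
  by have [D _ /(_ D (leqnn D)) HD] := near_infty_natSinv_lt (PosNum eps0); exists D.
apply: (@limn_esup_ub _ _ _ (2 + 4 * D.+1 * (c + 4))) => n Hn.
rewrite -EFinD lee_fin.
have C0 : (0 < ('C(n, 2)%:R : R))%R by rewrite ltr0n bin_gt0; lia.
apply: (@le_trans _ _ (1 / 2 + D.+1%:R^-1)%R); last by rewrite lerD2l ltW.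
rewrite ler_pdivrMr //.
have D0 : (0 < (D.+1%:R : R))%R by rewrite ltr0n.
have K : 2 * D.+1 * #|S_ n m f| <= (D.+1 + 2) * 'C(n, 2).
  exact: half_density_arith (card_S_excluded n m f) (bin2_sqr n) (H n) Hn.
rewrite -(ler_pM2l D0) mulrDl mulrDr !mulrA mulfV ?mul1r ?gt_eqF //.
rewrite -(ler_nat R) !natrM natrD in K; move: K.
by move: (#|_|%:R)%R ('C(_, _)%:R)%R (D.+1%:R)%R => x y z; lra.
Qed.

(** The hypothesis states a density of at least [1/2 - 1/D] for all large [n], cleared of
    denominators. *)
Lemma sigma_ge_half (R : realType) (m f : nat) :
  (forall D, exists N, forall n, N <= n -> D * 'C(n, 2) <= 2 * D * #|S_ n m f| + 2 * 'C(n, 2)) ->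
  ((1 / 2)%R%:E <= sigma R m f)%E.
Proof.
move=> H; apply/lee_addgt0Pr => eps eps0.
have [D HD] : exists D : nat, ((D.+1%:R : R)^-1 < eps)%R.
  by have [D _ /(_ D (leqnn D)) HD] := near_infty_natSinv_lt (PosNum eps0); exists D.
have [N HN] := H D.+1.
rewrite -leeBlDr //; apply: (@limn_esup_lb _ _ _ (N + 2)) => n Hn.
rewrite -EFinB lee_fin.
have C0 : (0 < ('C(n, 2)%:R : R))%R by rewrite ltr0n bin_gt0; lia.
apply: (@le_trans _ _ (1 / 2 - D.+1%:R^-1)%R); first by rewrite lerD2l lerN2 ltW.
rewrite ler_pdivlMr //.
have D0 : (0 < (D.+1%:R : R))%R by rewrite ltr0n.
have /HN K : N <= n by lia.
rewrite -(ler_pM2l D0) mulrBl mulrBr !mulrA mulfV ?mul1r ?gt_eqF //.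
rewrite -(ler_nat R) natrD !natrM in K; move: K.
by move: (#|_|%:R)%R ('C(_, _)%:R)%R (D.+1%:R)%R => x y z; lra.
Qed.

Theorem sigma_upper (R : realType) (m f : nat) : 2 <= m -> f <= 'C(m, 2) ->
  (m, f) \notin calA -> (sigma R m f <= (1 / 2)%R%:E)%E.
Proof.
move=> m2 fm nA.
set g := 'C(m, 2) - f; have fg : f + g = 'C(m, 2) by rewrite subnKC.
have Eg n : excluded n m g = excluded n m f by rewrite excluded_cograph.
have [Hf|Hf] := leqP (4 * f) (m ^ 2); last first.
  by apply: (@sigma_le_half _ _ _ 1) => n; have := excluded_bipartite n Hf; lia.
have [Hg|Hg] := leqP (4 * g) (m ^ 2); last first.
  by apply: (@sigma_le_half _ _ _ 1) => n; rewrite -Eg; have := excluded_bipartite n Hg; lia.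
have [sf|sf] := pselect (clique_star_size m f); last first.
  by apply: (@sigma_le_half _ _ _ 1) => n; have := excluded_clique_star n sf; lia.
have [sg|sg] := pselect (clique_star_size m g); last first.
  by apply: (@sigma_le_half _ _ _ 1) => n; rewrite -Eg; have := excluded_clique_star n sg; lia.
have [cf|cf] := pselect (clique_matching_size m f); last first.
  by apply: (@sigma_le_half _ _ _ 9) => n; apply: excluded_clique_matching.
have [cg|cg] := pselect (clique_matching_size m g); last first.
  by apply: (@sigma_le_half _ _ _ 9) => n; rewrite -Eg; apply: excluded_clique_matching.
have [m19|m19] := ltnP m 19.
  have := small_critical _ fg Hf Hg sf sg cf cg; rewrite m2 m19 => /(_ isT).
  move: nA; rewrite /calA /small_cases !inE !negb_or !xpair_eqE.
  move=> nA S; have [Em Ef] : m = 3 /\ (f = 1 \/ f = 2) by lia.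
  have E32 n : excluded n m f = excluded n 3 2.
    by rewrite Em; case: Ef => ->//; rewrite -(@excluded_cograph n 3 2).
  by apply: (@sigma_le_half _ _ _ 2) => n; rewrite E32; have := excluded_clique_union n; lia.
have [Efg Ek] := critical_pair m19 fg Hf Hg sf sg cf cg.
have f2 : 2 * f = 'C(m, 2) by rewrite -fg -Efg mul2n addnn.
apply: (@sigma_le_half _ _ _ 2) => n.
by have := excluded_half_bipartite n f2 (no_large_critical m19 f2 Ek); lia.
Qed.

(** * Ramsey and common neighbourhoods *)

Lemma subset_of_card (T : finType) (A : {set T}) (k : nat) : k <= #|A| ->
  exists2 B : {set T}, B \subset A & #|B| = k.
Proof.
move=> /card_geqP[s [us ss sA]]; exists [set:: s]%SET; last by rewrite cardsE (card_uniqP us).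
by apply/fintype.subsetP => x; rewrite inE => /sA.
Qed.

Definition homog (V : finType) (r : rel V) (b : bool) (A : {set V}) : Prop :=
  forall i j, i \in A -> j \in A -> i != j -> r i j = b.

Definition cross (V : finType) (r : rel V) (b : bool) (A B : {set V}) : Prop :=
  forall i j, i \in A -> j \in B -> r i j = b.

Lemma homogS (V : finType) (r : rel V) (b : bool) (A B : {set V}) :
  A \subset B -> homog r b B -> homog r b A.
Proof. by move=> /fintype.subsetP AB H i j iA jA; apply: H; apply: AB. Qed.

Lemma crossS (V : finType) (r : rel V) (b : bool) (A B A' B' : {set V}) :
  A' \subset A -> B' \subset B -> cross r b A B -> cross r b A' B'.
Proof.
by move=> /fintype.subsetP AA /fintype.subsetP BB H i j iA jB; apply: H; [apply: AA | apply: BB].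
Qed.

(** Induction on [s + t]: apart from a vertex [v], the set splits into neighbours and non-neighbours
    of [v], and one of the two has at least [2 ^ (s + t - 1)] elements. *)
Lemma ramsey_offdiag (V : finType) (r : rel V) (s t : nat) (A : {set V}) : symmetric r ->
  2 ^ (s + t) <= #|A| ->
  (exists B : {set V}, [/\ B \subset A, #|B| = s & homog r true B]) \/
  (exists B : {set V}, [/\ B \subset A, #|B| = t & homog r false B]).
Proof.
move=> rs; have [k Ek] : exists k, k = s + t by exists (s + t).
have empty b (A0 : {set V}) : exists B : {set V}, [/\ B \subset A0, #|B| = 0 & homog r b B].
  by exists finset.set0; rewrite finset.sub0set cards0; split=> // i j; rewrite inE.
elim: k s t Ek A => [|k IH] s t Ek A HA.
  have [-> _] : s = 0 /\ t = 0 by lia.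
  by left.
case: s Ek HA => [|s] Ek HA; first by left.
case: t Ek HA => [|t] Ek HA; first by right.
have /card_gt0P[v vA] : 0 < #|A| by apply: leq_trans HA; rewrite expn_gt0.
pose N := [set x in A | (x != v) && r v x]%SET.
pose M := [set x in A | (x != v) && ~~ r v x]%SET.
have cA : #|A| = (#|N| + #|M|).+1.
  rewrite (cardsD1 v) vA -(cardsID N (A :\ v)) add1n; congr (_ + _).+1.
    by apply: eq_card => x; rewrite !inE; case: (x \in A); case: (x == v); case: (r v x).
  by apply: eq_card => x; rewrite !inE; case: (x \in A); case: (x == v); case: (r v x).
have E2 : 2 ^ (s.+1 + t.+1) = 2 ^ (s + t.+1) + 2 ^ (s.+1 + t).
  by rewrite addSn expnS addSnnS; lia.
have NA : N \subset A by apply/fintype.subsetP => x; rewrite inE => /andP[].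
have MA : M \subset A by apply/fintype.subsetP => x; rewrite inE => /andP[].
have addv (b : bool) (B : {set V}) : (forall x, x \in B -> x != v /\ r v x = b) ->
    homog r b B -> #|v |: B|%SET = #|B|.+1 /\ homog r b (v |: B)%SET.
  move=> HB hB; split.
    rewrite cardsU1 (_ : v \notin B) //; apply/negP => /HB[]; by rewrite eqxx.
  move=> i j; rewrite !inE => /orP[/eqP->|iB] /orP[/eqP->|jB] ij.
  - by rewrite eqxx in ij.
  - by have [] := HB j jB.
  - by rewrite rs; have [] := HB i iB.
  - exact: hB.
have [HN|HM] : 2 ^ (s + t.+1) <= #|N| \/ 2 ^ (s.+1 + t) <= #|M|.
  by move: HA; rewrite E2 cA; clear; lia.
- have [|[B [BN Bs hB]]|[B [BN Bt hB]]] := IH s t.+1 _ N HN; first by lia.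
    have [|c h] := addv true B _ hB.
      by move=> x /(fintype.subsetP BN); rewrite inE => /and3P[_ -> ->].
    left; exists (v |: B)%SET; rewrite c Bs; split=> //.
    by rewrite finset.subUset finset.sub1set vA (fintype.subset_trans BN).
  by right; exists B; split=> //; apply: fintype.subset_trans NA.
- have [|[B [BN Bs hB]]|[B [BN Bt hB]]] := IH s.+1 t _ M HM; first by lia.
    by left; exists B; split=> //; apply: fintype.subset_trans MA.
  have [|c h] := addv false B _ hB.
    by move=> x /(fintype.subsetP BN); rewrite inE => /and3P[_ -> /negbTE].
  right; exists (v |: B)%SET; rewrite c Bt; split=> //.
  by rewrite finset.subUset finset.sub1set vA (fintype.subset_trans BN).
Qed.

Lemma ramsey (V : finType) (r : rel V) (t : nat) (A : {set V}) : symmetric r ->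
  2 ^ (t + t) <= #|A| ->
  exists b (B : {set V}), [/\ B \subset A, #|B| = t & homog r b B].
Proof.
by move=> rs /(ramsey_offdiag rs)[[B HB]|[B HB]]; [exists true | exists false]; exists B.
Qed.

(** Fix [2 t] vertices of [A]. By pigeonhole, [t] vertices of [B] have the same neighbourhood [W]
    among them, and either [W] or its complement there has [t] elements. *)
Lemma bipartite_ramsey (V : finType) (r : rel V) (t : nat) (A B : {set V}) : symmetric r ->
  t + t <= #|A| -> t * 2 ^ (t + t) <= #|B| ->
  exists b (A' B' : {set V}), [/\ A' \subset A, B' \subset B, #|A'| = t, #|B'| = t & cross r b A' B'].
Proof.
move=> rs /subset_of_card[A0 AA A0t] HB.
have [t0|t0] := posnP t.
  exists true, finset.set0, finset.set0; rewrite !finset.sub0set !cards0 t0; split=> //.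
  by move=> i j; rewrite inE.
pose F y := [set x in A0 | r x y]%SET.
have [W HW] : exists W : {set V}, t <= #|[set y in B | F y == W]%SET|.
  apply: contrapT => H.
  have {}H W : #|[set y in B | F y == W]%SET| <= t.-1.
    by rewrite -ltnS prednK // ltnNge; apply/negP => ?; apply: H; exists W.
  have: #|B| <= t.-1 * 2 ^ (t + t).
    rewrite -sum1_card (partition_big F (fun W => W \in powerset A0)) /=; last first.
      by move=> y _; rewrite powersetE; apply/fintype.subsetP => x; rewrite inE => /andP[].
    apply: (@leq_trans (\sum_(W in powerset A0) t.-1)).
      by apply: leq_sum => W _; rewrite sum1_card; have := H W; rewrite cardsE.
    by rewrite sum_nat_const card_powerset A0t mulnC.
  rewrite leqNgt => /negP; apply; apply: leq_trans HB.
  by rewrite ltn_pmul2r ?expn_gt0 // prednK.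
have [B' B'W B't] := subset_of_card HW.
have BB : B' \subset B.
  by apply: fintype.subset_trans B'W _; apply/fintype.subsetP => y; rewrite inE => /andP[].
have FW y : y \in B' -> F y = W.
  by move=> /(fintype.subsetP B'W); rewrite inE => /andP[_ /eqP].
have [y0 y0B] : exists y, y \in B' by apply/card_gt0P; rewrite B't.
have WA : W \subset A0 by rewrite -(FW y0) //; apply/fintype.subsetP => x; rewrite inE => /andP[].
have [/subset_of_card[A' A'W A't]|Wt] := leqP t #|W|.
  exists true, A', B'; split=> //.
    by apply: fintype.subset_trans AA; apply: fintype.subset_trans WA.
  move=> x y /(fintype.subsetP A'W) xW /FW FyW; rewrite -FyW inE in xW.
  by case/andP: xW.
have /subset_of_card[A' A'W A't] : t <= #|A0 :\: W|%SET.
  by have := cardsID W A0; rewrite (finset.setIidPr WA) A0t; lia.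
exists false, A', B'; split=> //.
  by apply: fintype.subset_trans AA; apply: fintype.subset_trans A'W _; rewrite finset.subsetDl.
move=> x y /(fintype.subsetP A'W); rewrite inE => /andP[xW xA] /FW FyW.
by move: xW; rewrite -FyW inE xA => /negbTE.
Qed.

(* Among [s = 4 D t] vertices of high degree, a positive proportion of [Y] sees at
   least [t]; by pigeonhole one of the at most [2 ^ s] subsets is seen often. *)
Lemma common_neighbors (D t : nat) : 0 < D -> exists D' n0 : nat,
  forall (X Y : finType) (r : X -> Y -> bool), n0 <= #|X| ->
  #|X| * #|Y| <= D * \sum_x \sum_y r x y ->
  exists2 W : {set X}, #|W| = t & #|Y| <= D' * #|[set y | [forall x in W, r x y]]%SET|.
Proof.
(* At least [#|X| / (2 D)] vertices have degree at least [#|Y| / (2 D)], so [2 * D * s] vertices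
   supply [s] of them. A [y] sees [2 t] of these on average, so [#|Y| / (4 D)] of the [y] see at
   least [t]; the factor [2 ^ s] is the pigeonhole loss. The summand [t] serves the case of empty
   [Y]. *)
move=> D0; pose s := 4 * D * t; exists (4 * D * 2 ^ s), (2 * D * s + t) => X Y r Xn H.
have XT : #|X| = #|[set: X]%SET| by rewrite cardsT.
have [t0|t0] := posnP t.
  exists finset.set0; first by rewrite cards0 t0.
  rewrite (_ : [set y | _]%SET = [set: Y]%SET) ?cardsT.
    by rewrite leq_pmull // !muln_gt0 expn_gt0 D0.
  by apply/setP => y; rewrite !inE; apply/forallP => x; rewrite inE.
have [Y0|Y0] := posnP #|Y|.
  have [|W _ Wt] := @subset_of_card X [set: X]%SET t; last by exists W; rewrite ?Y0.
  by rewrite -XT; apply: leq_trans Xn; rewrite leq_addl.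
pose deg x := \sum_y r x y.
have degY x : deg x <= #|Y| by rewrite -sum1_card; apply: leq_sum => y _; case: (r _ _).
pose Hv := [set x | #|Y| <= 2 * D * deg x]%SET.
have HvX : #|X| <= 2 * D * #|Hv|.
  have: 2 * D * \sum_x deg x <= 2 * D * #|Hv| * #|Y| + #|X| * #|Y|.
    rewrite (bigID (mem Hv)) /= mulnDr; apply: leq_add.
      rewrite -[leqRHS]mulnA leq_mul2l; apply/orP; right.
      by rewrite -sum_nat_const; apply: leq_sum => x _; apply: degY.
    rewrite big_distrr /= -sum_nat_const big_mkcond /=; apply: leq_sum => x _.
    by rewrite inE; have [|/ltnW] /= := leqP #|Y| (2 * D * deg x).
  have H1 : #|X| * #|Y| <= D * \sum_x deg x by [].
  have: #|X| * #|Y| <= 2 * D * #|Hv| * #|Y| -> #|X| <= 2 * D * #|Hv| by rewrite leq_pmul2r.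
  move=> H3 H2; apply: H3; move: H1 H2; clear.
  by move: (\sum_x deg x) (#|X| * #|Y|) (2 * D * #|Hv| * #|Y|) => a b c; lia.
have /subset_of_card[X0 X0H X0s] : s <= #|Hv|.
  by rewrite -(@leq_pmul2l (2 * D)) ?muln_gt0 //; apply: leq_trans HvX; apply: leq_trans Xn; rewrite leq_addr.
pose d0 y := \sum_(x in X0) r x y.
have Sd0 : 2 * t * #|Y| <= \sum_y d0 y.
  rewrite -(@leq_pmul2l (2 * D)) ?muln_gt0 // exchange_big big_distrr /=.
  apply: (@leq_trans (\sum_(x in X0) #|Y|)).
    by rewrite sum_nat_const X0s /s; apply: eq_leq; move: (#|Y|) => y; clear; lia.
  by apply: leq_sum => x /(fintype.subsetP X0H); rewrite inE.
have d0s y : d0 y <= s by rewrite -X0s; apply: sum_le_card => x; case: (r _ _).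
pose good := [set y | t <= d0 y]%SET.
have Hgood : #|Y| <= 4 * D * #|good|.
  have: \sum_y d0 y <= #|good| * s + #|Y| * t.
    rewrite (bigID (mem good)) /=; apply: leq_add.
      by rewrite -sum_nat_const; apply: leq_sum.
    rewrite -sum_nat_const big_mkcond /=; apply: leq_sum => y _.
    by rewrite inE; have [|/ltnW] /= := leqP t (d0 y).
  move=> /(leq_trans Sd0) Hs.
  by rewrite -(@leq_pmul2l t) //; move: Hs; rewrite /s; clear; lia.
pose com (W : {set X}) := #|[set y | [forall x in W, r x y]]%SET|.
have sumcom : #|good| <= \sum_(W in powerset X0 | #|W| == t) com W.
  have -> : \sum_(W in powerset X0 | #|W| == t) com W =
      \sum_y \sum_(W in powerset X0 | #|W| == t) [forall x in W, r x y].
    rewrite exchange_big /=; apply: eq_bigr => W _.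
    by rewrite /com -sum1_card big_mkcond /=; apply: eq_bigr => y _; rewrite inE; case: forallP.
  rewrite -sum1_card big_mkcond /=; apply: leq_sum => y _; rewrite inE.
  have [ty|//] := leqP t (d0 y).
  have : t <= #|[set x in X0 | r x y]%SET|.
    apply: leq_trans ty _; rewrite /d0 -sum1_card [leqRHS]big_mkcond [leqLHS]big_mkcond.
    by apply: leq_sum => x _; rewrite inE; case: (x \in X0); case: (r _ _).
  move=> /subset_of_card[W WX Wt].
  rewrite (bigD1 W) /=; last first.
    rewrite powersetE Wt eqxx andbT; apply: fintype.subset_trans WX _.
    by apply/fintype.subsetP => x; rewrite inE => /andP[].
  apply: leq_trans (leq_addr _ _); rewrite lt0b; apply/forallP => x; apply/implyP => /(fintype.subsetP WX).
  by rewrite inE => /andP[].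
apply: contrapT => HW.
have {}HW (W : {set X}) : #|W| = t -> 4 * D * 2 ^ s * com W <= #|Y|.-1.
  move=> Wt; rewrite -ltnS prednK // ltnNge; apply/negP => HWY; apply: HW.
  by exists W.
have: 4 * D * 2 ^ s * #|good| <= 2 ^ s * #|Y|.-1.
  apply: (@leq_trans (4 * D * 2 ^ s * \sum_(W in powerset X0 | #|W| == t) com W)).
    by rewrite leq_mul2l sumcom orbT.
  rewrite big_distrr /= -[in leqRHS]X0s -card_powerset -sum_nat_const big_mkcondr /=.
  by apply: leq_sum => W _; case: eqP => // /HW.
rewrite leqNgt => /negP; apply.
rewrite -mulnA mulnCA ltn_pmul2l ?expn_gt0 //; apply: leq_trans Hgood.
by rewrite prednK.
Qed.

(** * Unavoidable patterns *)

Lemma biclique_exists (D s : nat) : 0 < D -> exists n0, forall (V : finType) (r : rel V),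
  n0 <= #|V| -> #|V| ^ 2 <= D * \sum_i \sum_j r i j ->
  exists A B : {set V}, [/\ #|A| = s, #|B| = s & cross r true A B].
Proof.
move=> D0; have [D' [n0 H]] := common_neighbors s D0.
exists (n0 + D' * s + 1) => V r Vn HV.
have [|W Ws] := H V V r _ HV; first by apply: leq_trans Vn; rewrite -addnA leq_addr.
set N := [set y | _]%SET => HN.
have /subset_of_card[B BN Bs] : s <= #|N|.
  have: D' * s < D' * #|N| by move: HN Vn; clear; lia.
  by rewrite ltn_mul2l => /andP[_ /ltnW].
exists W, B; split=> // i j iW /(fintype.subsetP BN); rewrite inE => /forallP/(_ i).
by rewrite iW.
Qed.

(** Stated as a relation between vertices and ordered pairs, so that [common_neighbors] applies to
    it. *)
Definition triangle (V : finType) (r : rel V) (w : V) (p : V * V) : bool :=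
  [&& r p.1 p.2, r p.1 w & r p.2 w].

(** Adjacent [i], [j] have at least [d i + d j - #|V|] common neighbours. Summing over ordered edges
    gives [2 \sum_i d i ^ 2] on the left, which Cauchy-Schwarz bounds below. *)
Lemma sum_triangles (V : finType) (r : rel V) : symmetric r ->
  2 * (\sum_i \sum_j r i j) ^ 2 <=
  #|V| * (#|V| * (\sum_i \sum_j r i j) + \sum_w \sum_p triangle r w p).
Proof.
move=> rs; set P := \sum_i _; pose d i := \sum_j r i j.
have cauchy : P ^ 2 <= #|V| * \sum_i d i ^ 2.
  have [V0|V0] := posnP #|V|.
    by rewrite /P big1 // => i _; have := fintype0 i V0.
  have sumc c : \sum_(i : V) c = #|V| * c by rewrite -sum_nat_const; apply: eq_bigl.
  have: \sum_i (2 * (#|V| * d i * P)) <= \sum_i ((#|V| * d i) ^ 2 + P ^ 2).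
    by apply: leq_sum => i _; rewrite (nat_Cauchy (#|V| * d i) P).
  rewrite [X in _ <= X -> _]big_split /= sumc -!big_distrr /= -big_distrl -big_distrr /=.
  under [X in _ <= X + _]eq_bigr => i _ do rewrite expnMn.
  rewrite -big_distrr /= -[\sum_i d i]/P => H.
  have: #|V| * P ^ 2 <= #|V| * (#|V| * \sum_i d i ^ 2).
    by move: H; move: P (#|V|) (\sum_i d i ^ 2); clear => P n q; lia.
  by rewrite leq_pmul2l.
have codeg i j : r i j * (d i + d j) <= r i j * #|V| + \sum_w triangle r w (i, j).
  rewrite /triangle /=; case: (r i j); last by rewrite !mul0n.
  rewrite !mul1n -sum1_card -!big_split /=; apply: leq_sum => w _.
  by case: (r i w); case: (r j w).
have: \sum_i \sum_j r i j * (d i + d j) <= \sum_i \sum_j (r i j * #|V| + \sum_w triangle r w (i, j)).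
  by apply: leq_sum => i _; apply: leq_sum => j _; apply: codeg.
have -> : \sum_i \sum_j r i j * (d i + d j) = 2 * \sum_i d i ^ 2.
  under eq_bigr => i _ do under eq_bigr => j _ do rewrite mulnDr.
  under eq_bigr => i _ do rewrite big_split /=.
  rewrite big_split /= mul2n -addnn; congr (_ + _).
    by apply: eq_bigr => i _; rewrite -big_distrl /= mulnn.
  rewrite exchange_big /=; apply: eq_bigr => i _; rewrite -big_distrl /= -mulnn.
  by congr (_ * _); apply: eq_bigr => j _; rewrite rs.
have -> : \sum_i \sum_j (r i j * #|V| + \sum_w triangle r w (i, j)) =
    P * #|V| + \sum_w \sum_p triangle r w p.
  under eq_bigr => i _ do rewrite big_split /=.
  rewrite big_split /=; congr (_ + _).
    by rewrite /P big_distrl; apply: eq_bigr => i _; rewrite big_distrl.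
  rewrite [RHS]exchange_big /= pair_bigA /=.
  by apply: eq_bigr => -[].
move: (\sum_w \sum_p triangle r w p) (\sum_i d i ^ 2) (#|V|) cauchy => tri q n H1 H2.
apply: (@leq_trans (n * (2 * q))); first by move: H1; clear; lia.
by rewrite leq_mul2l; apply/orP; right; move: H2; clear; lia.
Qed.

(** Density [1/2 + 1/D] gives a positive proportion of triangles. Then [s] vertices complete a
    positive proportion of the pairs to triangles, and these pairs, read as a relation, contain a
    biclique. *)
Lemma triclique_exists (D s : nat) : 0 < D -> 0 < s -> exists n0, forall (V : finType) (r : rel V),
  symmetric r -> n0 <= #|V| -> (D + 2) * #|V| ^ 2 <= 2 * D * \sum_i \sum_j r i j ->
  exists A B C : {set V}, [/\ #|A| = s, #|B| = s & #|C| = s] /\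
    [/\ cross r true A B, cross r true A C & cross r true B C].
Proof.
move=> D0 s0; have [D1 [n1 H1]] := common_neighbors s D0.
have [n2 H2] := biclique_exists s (isT : 0 < D1.+1).
exists (n1 + n2 + 1) => V r rs Vn HP.
have V0 : 0 < #|V| by lia.
have Htri : #|V| * #|{: V * V}| <= D * \sum_w \sum_p triangle r w p.
  have := sum_triangles rs; rewrite card_prod; move: HP V0; clear.
  move: (\sum_w \sum_p triangle r w p) (\sum_i \sum_j r i j) (#|V|) => tri P n HP V0 HT.
  have Q1 : n ^ 2 <= 2 * P by nia.
  have Q2 : n * (2 * n * P) <= n * (D * tri) by nia.
  have Q3 : 2 * n * P <= D * tri by rewrite leq_pmul2l in Q2.
  by nia.
have [|W Ws HW] := H1 V {: V * V}%type (triangle r) _ Htri; first by move: Vn; clear; lia.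
pose r2 : rel V := fun u v => [forall w in W, triangle r w (u, v)].
have [||A [B [As Bs AB]]] := H2 V r2.
- by move: Vn; clear; lia.
- rewrite card_prod mulnn in HW; apply: leq_trans HW _.
  suff -> : #|[set y | [forall x in W, triangle r x y]]%SET| = \sum_u \sum_v r2 u v.
    by rewrite leq_mul2r leqnSn orbT.
  rewrite pair_bigA /= -sum1_card big_mkcond; apply: eq_bigr => -[u v] _.
  by rewrite inE /r2; case: [forall w in W, _].
have [w0 w0W] : exists w, w \in W by apply/card_gt0P; rewrite Ws.
have [a0 a0A] : exists w, w \in A by apply/card_gt0P; rewrite As.
have [b0 b0B] : exists w, w \in B by apply/card_gt0P; rewrite Bs.
have T u v w : u \in A -> v \in B -> w \in W -> triangle r w (u, v).
  by move=> uA vB wW; have /forallP/(_ w) := AB u v uA vB; rewrite wW.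
exists W, A, B; split=> //; split.
- by move=> w u wW uA; have /and3P[_ + _] := T u b0 w uA b0B wW; rewrite rs.
- by move=> w v wW vB; have /and3P[_ _] := T a0 v w a0A vB wW; rewrite rs.
- by move=> u v uA vB; have /and3P[] := T u v w0 uA vB w0W.
Qed.

Lemma disjoint_cross (V : finType) (r : rel V) (A B : {set V}) : irreflexive r ->
  cross r true A B -> [disjoint A & B].
Proof.
move=> ri H; rewrite -setI_eq0; apply/eqP/setP => x; rewrite !inE.
by apply/negP => /andP[xA xB]; have := H x x xA xB; rewrite ri.
Qed.

Variant unavoidable_pattern (V : finType) (r : rel V) (t : nat) : Prop :=
| CliqueIndep (b : bool) (A B : {set V}) of #|A| = t & #|B| = t & [disjoint A & B]
    & homog r true A & homog r false B & cross r b A B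
| BipartiteIndep (A B : {set V}) of #|A| = t & #|B| = t & [disjoint A & B]
    & homog r false A & homog r false B & cross r true A B
| ThreeCliques (A B C : {set V}) of [/\ #|A| = t, #|B| = t & #|C| = t]
    & [/\ [disjoint A & B], [disjoint A & C] & [disjoint B & C]]
    & [/\ homog r true A, homog r true B & homog r true C]
    & [/\ cross r false A B, cross r false A C & cross r false B C].

Lemma homog_of_size (V : finType) (r : rel V) (b : bool) (T t : nat) (A : {set V}) :
  symmetric r -> t <= T -> 2 ^ (T + T) <= #|A| ->
  (forall B : {set V}, #|B| = T -> ~ homog r (~~ b) B) ->
  exists B : {set V}, [/\ B \subset A, #|B| = t & homog r b B].
Proof.
move=> rs tT HA H; have [b' [B [BA BT hB]]] := ramsey rs HA.
have Eb : b' = b by case: b' b hB H => -[] // hB H; case: (H B BT).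
rewrite Eb in hB; have [|B' B'B B't] := @subset_of_card V B t; first by rewrite BT.
exists B'; split=> //; first exact: fintype.subset_trans BA.
exact: homogS hB.
Qed.

(* A large clique and a large independent set yield the first pattern by
   bipartite Ramsey. If large cliques are missing, the two sides of a biclique
   contain independent sets; if large independent sets are missing, the three
   parts of a complete tripartite subgraph of the complement contain cliques. *)
Lemma unavoidable (D t : nat) : 0 < D -> exists n0, forall (V : finType) (r : rel V),
  symmetric r -> irreflexive r -> n0 <= #|V| ->
  #|V| ^ 2 <= D * \sum_i \sum_j r i j ->
  2 * D * (\sum_i \sum_j r i j) + 2 * #|V| ^ 2 <= D * #|V| ^ 2 ->
  unavoidable_pattern r t.
Proof.
move=> D0; pose T := t * 2 ^ (t + t) + t + t + 1; pose s := 2 ^ (T + T).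
have tT : t <= T by rewrite /T; lia.
have s0 : 0 < s by rewrite expn_gt0.
have [n1 H1] := biclique_exists s D0.
(* The complement has ordered density at least [1/2 + 1/D] minus [1/n] for the diagonal; for
   [n >= 2 D] this leaves [1/2 + 1/(2 D)]. *)
have [n2 H2] := @triclique_exists (2 * D) s ltac:(lia) s0.
exists (n1 + n2 + 2 * D) => V r rs ri Vn Plo Phi.
have [[A [AT hA]]|noA] := pselect (exists A : {set V}, #|A| = T /\ homog r true A); last first.
  have {}noA (A : {set V}) : #|A| = T -> ~ homog r (~~ false) A.
    by move=> AT hA; apply: noA; exists A.
  have [|A [B [As Bs AB]]] := H1 V r _ Plo; first by move: Vn; clear; lia.
  have [|A' [A'A A't hA]] := homog_of_size rs tT _ noA (A := A); first by rewrite As.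
  have [|B' [B'B B't hB]] := homog_of_size rs tT _ noA (A := B); first by rewrite Bs.
  have AB' := crossS A'A B'B AB.
  by apply: (@BipartiteIndep _ _ _ A' B') => //; apply: disjoint_cross AB'.
have [[B [BT hB]]|noB] := pselect (exists B : {set V}, #|B| = T /\ homog r false B); last first.
  have {}noB (B : {set V}) : #|B| = T -> ~ homog r (~~ true) B.
    by move=> BT hB; apply: noB; exists B.
  pose rc : rel V := fun i j => (i != j) && ~~ r i j.
  have rcs : symmetric rc by move=> i j; rewrite /rc eq_sym rs.
  have rci : irreflexive rc by move=> i; rewrite /rc eqxx.
  have rcP : \sum_i \sum_j r i j + \sum_i \sum_j rc i j + #|V| = #|V| ^ 2.
    rewrite -mulnn -!sum1_card big_distrlr /= -!big_split /=.
    apply: eq_bigr => i _; rewrite -big_split /= [RHS](bigD1 i) //= [in LHS](bigD1 i) //=.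
    rewrite ri rci !add0n addnC; congr (_ + _); apply: eq_bigr => j ji.
    by rewrite /rc eq_sym ji /=; case: (r i j).
  have [|//|A' [B' [C' [[As Bs Cs] [AB AC BC]]]]] := H2 V rc rcs; first by move: Vn; clear; lia.
    move: Vn Phi rcP; clear.
    move: (\sum_i \sum_j r i j) (\sum_i \sum_j rc i j) (#|V|) => p q n Vn Phi E.
    have Dn : 2 * D * n <= n ^ 2 by rewrite -mulnn leq_mul2r; lia.
    by nia.
  have ncr (X Y : {set V}) : cross rc true X Y -> cross r false X Y.
    by move=> H i j iX jY; have := H i j iX jY; rewrite /rc => /andP[_ /negbTE].
  have [|A1 [A1A A1t hA1]] := homog_of_size rs tT _ noB (A := A'); first by rewrite As.
  have [|B1 [B1B B1t hB1]] := homog_of_size rs tT _ noB (A := B'); first by rewrite Bs.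
  have [|C1 [C1C C1t hC1]] := homog_of_size rs tT _ noB (A := C'); first by rewrite Cs.
  have AB' := crossS A1A B1B AB; have AC' := crossS A1A C1C AC; have BC' := crossS B1B C1C BC.
  apply: (@ThreeCliques _ _ _ A1 B1 C1) => //; split; try exact: ncr.
  - exact: disjoint_cross AB'.
  - exact: disjoint_cross AC'.
  - exact: disjoint_cross BC'.
have BA1 : #|B :&: A|%SET <= 1.
  rewrite leqNgt; apply/negP => /card_gt1P[x [y [xI yI xy]]].
  move: xI yI; rewrite !inE => /andP[xB xA] /andP[yB yA].
  by have := hA x y xA yA xy; rewrite (hB x y xB yB xy).
have BAt : t * 2 ^ (t + t) <= #|B :\: A|%SET.
  by have := cardsID A B; rewrite BT /T; move: BA1; clear; lia.
have [|b [A' [B' [A'A B'B A't B't AB]]]] := @bipartite_ramsey V r t A (B :\: A)%SET rs _ BAt.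
  by rewrite AT /T; clear; lia.
have hA' := homogS A'A hA.
have hB' : homog r false B'.
  by apply: homogS hB; apply: fintype.subset_trans B'B _; rewrite finset.subsetDl.
apply: (@CliqueIndep _ _ _ b A' B') => //.
rewrite -setI_eq0; apply/eqP/setP => x; rewrite !inE; apply/negP => /andP[xA /(fintype.subsetP B'B)].
by rewrite inE (fintype.subsetP A'A _ xA).
Qed.

(** * The lower bound *)

Lemma sum_setU (V : finType) (A B : {set V}) (F : V -> nat) : [disjoint A & B] ->
  \sum_(i in A :|: B) F i = \sum_(i in A) F i + \sum_(i in B) F i.
Proof. by move=> AB; rewrite -bigU //; apply: eq_bigl => i; rewrite !inE. Qed.

Lemma pair_sum_setU (V : finType) (r : rel V) (A B : {set V}) : symmetric r ->
  [disjoint A & B] ->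
  pair_sum r (A :|: B) = pair_sum r A + pair_sum r B + 2 * \sum_(i in A) \sum_(j in B) r i j.
Proof.
move=> rs AB; rewrite /pair_sum sum_setU //.
have split_sum i : \sum_(j in A :|: B) r i j = \sum_(j in A) r i j + \sum_(j in B) r i j.
  by rewrite sum_setU.
under eq_bigr => i _ do rewrite split_sum.
under [X in _ + X]eq_bigr => i _ do rewrite split_sum.
rewrite !big_split /= (_ : \sum_(i in B) \sum_(j in A) r i j = \sum_(i in A) \sum_(j in B) r i j).
  by clear; lia.
by rewrite exchange_big; apply: eq_bigr => i _; apply: eq_bigr => j _; rewrite rs.
Qed.

Lemma pair_sum_homog (V : finType) (r : rel V) (b : bool) (A : {set V}) : irreflexive r ->
  homog r b A -> pair_sum r A = b * (2 * 'C(#|A|, 2)).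
Proof.
move=> ri H; suff: pair_sum r A + b * #|A| = b * #|A| ^ 2.
  by rewrite -(bin2_sqr #|A|); case: b {H}; clear; lia.
have row i : i \in A -> \sum_(j in A) r i j + b = b * #|A|.
  move=> iA; rewrite -sum1_card (bigD1 i) //= ri add0n [\sum_(j in A) 1](bigD1 i) //= mulnDr muln1.
  rewrite addnC big_distrr /=; congr (_ + _); apply: eq_bigr => j /andP[jA ji].
  by rewrite H 1?eq_sym ?muln1.
rewrite [b * #|A|]mulnC -sum_nat_const /pair_sum -big_split /= (eq_bigr _ row) sum_nat_const.
by rewrite mulnCA.
Qed.

Lemma sum_cross (V : finType) (r : rel V) (b : bool) (A B : {set V}) :
  cross r b A B -> \sum_(i in A) \sum_(j in B) r i j = b * (#|A| * #|B|).
Proof.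
move=> H; rewrite (eq_bigr (fun=> #|B| * b)) => [|i iA].
  by rewrite sum_nat_const mulnA mulnC.
by rewrite -sum_nat_const; apply: eq_bigr => j jB; rewrite H.
Qed.

Lemma disjointS (V : finType) (A B A' B' : {set V}) :
  A' \subset A -> B' \subset B -> [disjoint A & B] -> [disjoint A' & B'].
Proof. by move=> AA BB; move=> /(disjointWl AA); apply: disjointWr. Qed.

(** One decomposition per pattern: [k] clique vertices when no edges join the two sets; [k']
    independent vertices, missing ['C(k', 2)] edges, when all do; sides [a] and [m - a] of a
    biclique; parts [x], [y], [z] of three cliques. *)
Lemma pattern_realizes (V : finType) (r : rel V) (m f k k' a x y z : nat) :
  symmetric r -> irreflexive r -> unavoidable_pattern r m ->
  k <= m -> f = 'C(k, 2) -> k' <= m -> f + 'C(k', 2) = 'C(m, 2) ->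
  a <= m -> f = a * (m - a) -> x + y + z = m -> f = 'C(x, 2) + 'C(y, 2) + 'C(z, 2) ->
  exists2 U : {set V}, #|U| = m & pair_sum r U = 2 * f.
Proof.
move=> rs ri pat km Ek km' Ek' am Ea xyz Exyz.
have disj_card (A B : {set V}) : [disjoint A & B] -> #|A :|: B| = #|A| + #|B|.
  by move=> /disjoint_setI0 AB; rewrite cardsU AB cards0 subn0.
have two b1 b2 b (A B : {set V}) p q : #|A| = m -> #|B| = m -> [disjoint A & B] ->
    homog r b1 A -> homog r b2 B -> cross r b A B -> p + q = m ->
    b1 * 'C(p, 2) + b2 * 'C(q, 2) + b * (p * q) = f ->
    exists2 U : {set V}, #|U| = m & pair_sum r U = 2 * f.
  move=> Am Bm dAB hA hB cAB pq E.
  have [|A' A'A A'p] := @subset_of_card V A p; first by lia.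
  have [|B' B'B B'q] := @subset_of_card V B q; first by lia.
  have dAB' := disjointS A'A B'B dAB.
  exists (A' :|: B'); first by rewrite disj_card // A'p B'q.
  rewrite pair_sum_setU // (pair_sum_homog ri (homogS A'A hA)) (pair_sum_homog ri (homogS B'B hB)).
  rewrite (sum_cross (crossS A'A B'B cAB)) A'p B'q -E; clear.
  by case: b1; case: b2; case: b; lia.
case: pat => [[] A B Am Bm dAB hA hB cAB|A B Am Bm dAB hA hB cAB|A B C [Am Bm Cm] [dAB dAC dBC] [hA hB hC] [cAB cAC cBC]].
- apply: (two _ _ _ A B (m - k') k' Am Bm dAB hA hB cAB); first by lia.
  have: 2 * 'C(m - k', 2) + (m - k') = (m - k') ^ 2 by rewrite bin2_sqr.
  have := bin2_sqr k'; have := bin2_sqr m.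
  have [d Ed] : exists d, m = k' + d by exists (m - k'); lia.
  by move: Ek'; rewrite Ed addKn; clear; nia.
- apply: (two _ _ _ A B k (m - k) Am Bm dAB hA hB cAB); first by lia.
  by rewrite Ek; clear; lia.
- apply: (two _ _ _ A B a (m - a) Am Bm dAB hA hB cAB); first by lia.
  by rewrite Ea; clear; lia.
have [|A' A'A A'x] := @subset_of_card V A x; first by lia.
have [|B' B'B B'y] := @subset_of_card V B y; first by lia.
have [|C' C'C C'z] := @subset_of_card V C z; first by lia.
have dAB' := disjointS A'A B'B dAB.
have dC' : [disjoint A' :|: B' & C'].
  rewrite -setI_eq0 finset.setIUl; apply/eqP.
  by rewrite !disjoint_setI0 ?finset.setU0 ?(disjointS A'A C'C) ?(disjointS B'B C'C).
exists (A' :|: B' :|: C'); first by rewrite !disj_card // A'x B'y C'z.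
rewrite !pair_sum_setU // (pair_sum_homog ri (homogS A'A hA)) (pair_sum_homog ri (homogS B'B hB)).
rewrite (pair_sum_homog ri (homogS C'C hC)) sum_setU //.
rewrite (sum_cross (crossS A'A B'B cAB)) (sum_cross (crossS A'A C'C cAC)) (sum_cross (crossS B'B C'C cBC)).
by rewrite A'x B'y C'z Exyz; clear; lia.
Qed.

Lemma sum_arrow (n m f : nat) :
  #|S_ n m f| = \sum_(0 <= e < 'C(n, 2).+1) arrow n e m f.
Proof.
rewrite big_mkord -sum1_card big_mkcond /=; apply: eq_bigr => e _.
by rewrite inE; case: arrow.
Qed.

Lemma half_density_arith_lb (d n s C lo hi : nat) : 16 <= n -> 2 * C + n = n ^ 2 ->
  hi - lo <= s -> 4 * d * n ^ 2 < hi.+1 * (16 * d) + 2 * n ^ 2 ->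
  (lo - 1) * (8 * d) <= n ^ 2 -> d * C <= 2 * d * s + 2 * C.
Proof.
move=> n16 EC Hs Hhi Hlo.
have E1 : hi * (16 * d) <= (s + lo) * (16 * d) by rewrite leq_mul2r; apply/orP; right; lia.
have E2 : lo * (16 * d) <= 2 * n ^ 2 + 16 * d by nia.
have E3 : 4 * d * n ^ 2 <= 16 * d * s + 4 * n ^ 2 + 32 * d by nia.
have E4 : d * n ^ 2 <= 4 * (d * s) + n ^ 2 + 8 * d by nia.
suff: 2 * (d * C) <= 2 * (2 * d * s + 2 * C) by rewrite leq_mul2l.
have E5 : 2 * (d * C) + d * n = d * n ^ 2 by rewrite -EC; lia.
have E6 : 16 * d <= d * n by rewrite mulnC leq_mul2l n16 orbT.
have E7 : 2 * n <= n ^ 2 by nia.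
by clear -E4 E5 E6 E7 EC; lia.
Qed.

Lemma sigma_ge_half_of_patterns (R : realType) (m f k k' a x y z : nat) :
  k <= m -> f = 'C(k, 2) -> k' <= m -> f + 'C(k', 2) = 'C(m, 2) ->
  a <= m -> f = a * (m - a) -> x + y + z = m -> f = 'C(x, 2) + 'C(y, 2) + 'C(z, 2) ->
  ((1 / 2)%R%:E <= sigma R m f)%E.
Proof.
move=> km Ek km' Ek' am Ea xyz Exyz; apply: sigma_ge_half => d.
have [d0|d0] := posnP d; first by exists 0 => n _; rewrite d0.
pose D := 4 * d; have D0 : 0 < D by rewrite /D; lia.
have [n0 H0] := unavoidable m D0.
exists (n0 + 16 * d + 16) => n Hn.
(* The ordered sum is [2 e], so these bounds encode the two density conditions of [unavoidable]; the
   [+ 1] rounds up. With [D = 4 d] the width is about [n^2 / 4 - n^2 / (4 d)], a share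
   [1/2 - 1/(2 d)] of ['C(n, 2)]. *)
pose lo := n ^ 2 %/ (2 * D) + 1; pose hi := ((D - 2) * n ^ 2) %/ (4 * D).
have D2 : 2 <= D by rewrite /D; clear -d0; lia.
have HD : (D - 2) * n ^ 2 + 2 * n ^ 2 = D * n ^ 2 by rewrite -mulnDl subnK.
have arr e : lo <= e < hi -> arrow n e m f.
  move=> /andP[loe ehi]; apply/forallP => G; apply/implyP => /andP[sG /eqP eG].
  have EP : \sum_i \sum_j adj G i j = 2 * e.
    have := pair_sum_adj [set: 'I_n]%SET sG; rewrite induced_setT eG /pair_sum sum_setT.
    by under eq_bigr => i _ do rewrite sum_setT.
  have [|U Um Uf] := pattern_realizes (@adj_sym _ G) (@adj_irr _ G) _ km Ek km' Ek' am Ea xyz Exyz.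
    apply: (H0 'I_n (adj G) (@adj_sym _ G) (@adj_irr _ G)); rewrite ?card_ord ?EP.
    - by move: Hn; clear; lia.
    - have: n ^ 2 < lo * (2 * D) by rewrite /lo addn1 ltn_ceil // muln_gt0.
      have: lo * (2 * D) <= e * (2 * D) by rewrite leq_mul2r loe orbT.
      by clear; lia.
    - have: hi * (4 * D) <= (D - 2) * n ^ 2 by apply: leq_trunc_div.
      have: e * (4 * D) <= hi * (4 * D) by rewrite leq_mul2r (ltnW ehi) orbT.
      by move: HD; move: (n ^ 2) => N; clear; lia.
  apply/existsP; exists U; rewrite Um eqxx /=.
  by rewrite -(eqn_pmul2l (isT : 0 < 2)) -pair_sum_adj // Uf.
have hiD : hi * (4 * D) <= (D - 2) * n ^ 2 by apply: leq_trunc_div.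
have hiC : hi <= 'C(n, 2).+1.
  have: D * (4 * hi) <= D * n ^ 2.
    by apply: leq_trans (leq_mul (leq_subr 2 D) (leqnn _)); move: hiD; clear; lia.
  by rewrite leq_pmul2l //; have := bin2_sqr n; move: Hn; clear; nia.
have Scard : hi - lo <= #|S_ n m f|.
  rewrite sum_arrow; have [lohi|/ltnW] := leqP lo hi; last by rewrite -subn_eq0 => /eqP->.
  apply: leq_trans (sum_nat_le _ hiC).
  rewrite (big_cat_nat (leq0n lo) lohi) /=; apply: leq_trans (leq_addl _ _).
  rewrite [leqLHS](_ : _ = \sum_(lo <= i < hi) 1); last by rewrite sum_nat_const_nat muln1.
  rewrite big_nat_cond [leqRHS]big_nat_cond; apply: leq_sum => i; rewrite andbT => Hi.
  by rewrite arr.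
have n16 : 16 <= n by move: Hn; clear; lia.
have Hhi : 4 * d * n ^ 2 < hi.+1 * (16 * d) + 2 * n ^ 2.
  have: (D - 2) * n ^ 2 < hi.+1 * (4 * D) by rewrite ltn_ceil // muln_gt0.
  rewrite (_ : 16 * d = 4 * D); last by rewrite /D; clear; lia.
  by rewrite -/D -HD ltn_add2r.
have Hlo : (lo - 1) * (8 * d) <= n ^ 2.
  rewrite (_ : 8 * d = 2 * D); last by rewrite /D; clear; lia.
  by rewrite /lo addnK leq_trunc_div.
exact: half_density_arith_lb n16 (bin2_sqr n) Scard Hhi Hlo.
Qed.

(** * Infinitely many pairs from a Pell-type equation *)

Fixpoint pell (n : nat) : nat * nat :=
  if n is n'.+1 then let: (w, q) := pell n' in (8 * w + 21 * q, 3 * w + 8 * q) else (5, 2).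

(** The recursion multiplies [w + q sqrt 7] by [8 + 3 sqrt 7], a unit of norm 1, so the norm
    [w^2 - 7 q^2 = -3] of the start [(5, 2)] persists. *)
Lemma pellP (n : nat) : (pell n).1 ^ 2 + 3 = 7 * (pell n).2 ^ 2.
Proof. by elim: n => //= n; case: (pell n) => w q /= IH; nia. Qed.

Lemma pell_ge2 (n : nat) : 2 <= (pell n).2.
Proof. by elim: n => //= n; case: (pell n) => w q /= IH; lia. Qed.

Lemma pell_inj : injective (fun n => (pell n).2).
Proof.
have mono : {homo (fun n => (pell n).2) : i j / i < j}.
  apply: homo_ltn => [|n]; first exact: ltn_trans.
  by have := pell_ge2 n; rewrite /=; case: (pell n) => w q /=; lia.
move=> i j E; apply/eqP; rewrite eqn_leq leqNgt [j <= i]leqNgt; apply/andP.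
by split; apply/negP => /mono; rewrite E ltnn.
Qed.

Definition half_pair (n : nat) : nat * nat :=
  let q := (pell n).2 - 1 in (5 * q + 2, 'C(3 * q + 1, 2)).

(** With [m = 5 q + 2], the discriminant [m^2 - 4 f] of [a (m - a) = f] is [7 (q + 1)^2 - 3 = w^2],
    so [a = (m - w) / 2]; it is an integer because [m - w] is even. *)
Lemma pell_pair_bipartite (q w : nat) : w ^ 2 + 3 = 7 * (q + 1) ^ 2 ->
  exists2 a, a <= 5 * q + 2 & 'C(3 * q + 1, 2) = a * (5 * q + 2 - a).
Proof.
move=> HQ; have := bin2_sqr (3 * q + 1); move: ('C(3 * q + 1, 2)) => f Hf.
have [m Em] : exists m, m = 5 * q + 2 by exists (5 * q + 2).
rewrite -Em; have wf : w ^ 2 + 4 * f = m ^ 2 by subst m; clear -HQ Hf; nia.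
have wm : w <= m by clear -wf; nia.
have [c Ec] : exists c, m = w + c by exists (m - w); clear -wm; lia.
have cw : c * (c + 2 * w) = 4 * f by clear -wf Ec; subst m; nia.
have ec : ~~ odd c.
  apply/negP => oc; have: odd (c * (c + 2 * w)) by rewrite oddM oc oddD oc oddM.
  by rewrite cw oddM.
have [a Ea] : exists a, c = 2 * a by exists c./2; clear -ec; lia.
have aw : a * (a + w) = f by clear -cw Ea; subst c; lia.
exists a; first by clear -Ec Ea; lia.
by rewrite -aw; congr (a * _); clear -Ec Ea; lia.
Qed.

Lemma half_pair_sigma (R : realType) (n : nat) (p := half_pair n) :
  [/\ 2 <= p.1, p.2 <= 'C(p.1, 2) & sigma R p.1 p.2 = (1 / 2)%R%:E].
Proof.
rewrite /p /half_pair /=; have := pellP n; have := pell_ge2 n.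
case: (pell n) => w Q /= Q2 HQ.
have [q Eq] : exists q, Q = q + 1 by exists (Q - 1); lia.
rewrite Eq addnK; set m := 5 * q + 2; set f := 'C(3 * q + 1, 2).
have Hk := bin2_sqr (3 * q + 1); have Hk' := bin2_sqr (4 * q + 2); have Hm := bin2_sqr m.
have fm : f + 'C(4 * q + 2, 2) = 'C(m, 2).
  by move: Hk Hk' Hm; rewrite -/f /m; move: f 'C(_, 2) 'C(_, 2); clear => x y z; nia.
have fle : f <= 'C(m, 2) by rewrite -fm leq_addr.
split=> //; first by rewrite /m; lia.
apply/eqP; rewrite eq_le; apply/andP; split.
  apply: sigma_upper => //; first by rewrite /m; lia.
  by rewrite /calA !inE !xpair_eqE /m; lia.
have [a am Ea] : exists2 a, a <= m & f = a * (m - a).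
  by apply: (@pell_pair_bipartite q w); rewrite HQ Eq.
apply: (@sigma_ge_half_of_patterns R m f (3 * q + 1) (4 * q + 2) a (2 * q + 1) (2 * q + 1) q) => //.
- by rewrite /m; clear; lia.
- by rewrite /m; clear; lia.
- by rewrite /m; clear; lia.
- rewrite /f; have := bin2_sqr (2 * q + 1); have := bin2_sqr q; move: Hk; clear.
  by move: 'C(3 * q + 1, 2) 'C(2 * q + 1, 2) 'C(q, 2) => x y z; nia.
Qed.

Local Open Scope classical_set_scope.

Theorem theorem1p4 (R : realType) :
  (forall m f : nat, 2 <= m -> f <= 'C(m, 2) -> (m, f) \notin calA ->
     (sigma R m f <= (1 / 2)%R%:E)%E) /\
  infinite_set [set p : nat * nat |
     [/\ 2 <= p.1, p.2 <= 'C(p.1, 2) & sigma R p.1 p.2 = (1 / 2)%R%:E]].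
Proof.
split; first exact: sigma_upper.
set A := [set p | _]%classic => finA; apply: infinite_nat.
(* All naturals map into [A] injectively, so a finite [A] would make [nat] finite. *)
have -> : [set: nat]%classic = (half_pair @^-1` A)%classic.
  by apply/seteqP; split=> n // _; apply: half_pair_sigma.
apply: finite_preimage finA => i j _ _ E; apply: pell_inj.
have : (half_pair i).1 = (half_pair j).1 by rewrite E.
by rewrite /half_pair /=; have := pell_ge2 i; have := pell_ge2 j; lia.
Qed.
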